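(* Let $n\ge 3$ and $\Pi=\{0,1\}^n$. Let $W$ be an $n$-dimensional complex vector space with basis $\epsilon_1,\dots,\epsilon_n$, $W^\vee$ its dual, and $V=W\oplus W^\vee$ with the nondegenerate symmetric form $\langle (w_1,w_1^\vee),(w_2,w_2^\vee)\rangle=\tfrac12(w_1^\vee(w_2)+w_2^\vee(w_1))$. Let $S_+=\bigwedge^{\mathrm{even}}W$ and $S_-=\bigwedge^{\mathrm{odd}}W$ be the two half-spin representations of $\mathrm{Spin}(2n)=\mathrm{Spin}(V)$ (acting through the Clifford module structure on $\bigwedge^\bullet W$ in which $u\in W$ acts by $u\wedge\cdot$ and $u^\vee\in W^\vee$ acts by contraction). For $J\in\Pi$ let $v_J=\epsilon_{j_1}\wedge\cdots\wedge\epsilon_{j_r}$ where $j_1<\dots<j_r$ are the indices with $J_{j}=1$; use the bases $\{v_J\}_{J\in\Pi^{\mathrm{even}}}$ of $S_+$ and $\{v_J\}_{J\in\Pi^{\mathrm{odd}}}$ of $S_-$ to identify $\mathbb{P}(\mathbb{C}^{\Pi^{\mathrm{even}}})\times\mathbb{P}(\mathbb{C}^{\Pi^{\mathrm{odd}}})$ with $\mathbb{P}(S_+)\times\mathbb{P}(S_-)$. Let $\mathring{Y}'\subset(\mathbb{C}^\times)^\Pi$ be the solution set of $$x_I\,x_{I+e_j+e_k+e_\ell}+x_{I+e_j+e_\ell}\,x_{I+e_k}=x_{I+e_j+e_k}\,x_{I+e_\ell}+x_{I+e_k+e_\ell}\,x_{I+e_j}$$ for all $j<k<\ell$ and all admissible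 $I$, let $\mathring{X}'=\mathring{Y}'/(\mathbb{C}^\times)^2$ (where $(t,u)$ scales even coordinates by $t$ and odd coordinates by $u$), and let $X'$ be its closure in $\mathbb{P}(S_+)\times\mathbb{P}(S_-)$. Consider the embedding of $\mathrm{IG}(n-1,2n)$ (isotropic $(n-1)$-planes in $V$) given by the composite $\mathrm{IG}(n-1,2n)\hookrightarrow \mathrm{G}(n-1,2n)\hookrightarrow\mathbb{P}(\bigwedge^{n-1}V)\hookrightarrow\mathbb{P}(S_+\otimes S_-)$ (Plücker embedding followed by the $\mathrm{Spin}(2n)$-equivariant inclusion of the irreducible summand $\bigwedge^{n-1}V\subset S_+\otimes S_-$), whose image lies in the Segre image of $\mathbb{P}(S_+)\times\mathbb{P}(S_-)$. Then $X'$ equals the image of $\mathrm{IG}(n-1,2n)$ under this embedding.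
   Context: Even/odd elements of $\Pi$ are those with even/odd coordinate sum. $\bigwedge^{n-1}V$ occurs in $S_+\otimes S_-$ as the irreducible summand of highest weight $(2,\dots,2,0)$, so the equivariant inclusion is determined up to scalar; the isotropic subspace $\mathrm{span}(\epsilon_1,\dots,\epsilon_{n-1})$ maps to the product of the highest weight lines of $S_+$ and $S_-$. *)

(* Defs.v *)
From HB Require Import structures.
From mathcomp Require Import all_boot all_order all_algebra.
From mathcomp Require Import mpoly complex.
From mathcomp Require Import classical_sets reals.

Set Implicit Arguments.
Unset Strict Implicit.
Unset Printing Implicit Defensive.

Import GRing.Theory.

Local Open Scope ring_scope.

(* {0,1}^n is encoded as {set 'I_n}, J being the set of indices j with
   J_j = 1; thus I + e_j is j |: I when j \notin I. *)

(* The exterior algebra of F^d, in the coordinates of the basis (v_J)_J. *)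
Definition ext (F : fieldType) (d : nat) := {ffun {set 'I_d} -> F^o}.

Definition vb (F : fieldType) (d : nat) (J : {set 'I_d}) : ext F d :=
  [ffun K => (K == J)%:R].

Definition eb (F : fieldType) (d : nat) (j : 'I_d) : 'rV[F]_d := delta_mx 0 j.

Definition sgn (F : fieldType) (d : nat) (j : 'I_d) (K : {set 'I_d}) : F :=
  (-1) ^+ #|[pred k in K | (k < j)%N]|.

(* u /\ s; on the basis, e_j /\ v_J = (-1)^#{k in J | k < j} v_(J + e_j) if
   j \notin J, and 0 otherwise. *)
Definition wedge (F : fieldType) (d : nat) (u : 'rV[F]_d) (s : ext F d) :
    ext F d :=
  [ffun K : {set 'I_d} =>
     \sum_(j in K) sgn F j K * u 0 j * s (K :\ j)].

(* Contraction by the linear form with coordinates u in the dual basis; on the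
   basis, e_j^* contracts v_J to (-1)^#{k in J | k < j} v_(J - e_j) if j \in J,
   and to 0 otherwise. *)
Definition contract (F : fieldType) (d : nat) (u : 'rV[F]_d) (s : ext F d) :
    ext F d :=
  [ffun K : {set 'I_d} =>
     \sum_(j | j \notin K) sgn F j K * u 0 j * s (j |: K)].

Definition wedges (F : fieldType) (d : nat) (us : seq 'rV[F]_d) : ext F d :=
  foldr (@wedge F d) (vb F finset.set0) us.

Definition extpow (F : fieldType) (d k : nat) : {vspace ext F d} :=
  <<[seq vb F J | J : {set 'I_d} <- enum {set 'I_d} & #|J| == k]>>%VS.

(* The map induced on the exterior algebra by a linear map A. *)
Definition extmap (F : fieldType) (d : nat) (A : 'rV[F]_d -> 'rV[F]_d)
    (w : ext F d) : ext F d :=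
  \sum_(K : {set 'I_d}) (w K : F) *: wedges [seq A (eb F k) | k <- enum K].

(* V = W + W^*, W = F^n: the left block of a row holds the coordinates in the
   basis e_1, .., e_n of W, the right block those in the dual basis of W^*. *)
Definition V (F : fieldType) (n : nat) := 'rV[F]_(n + n).

Definition pairing (F : fieldType) (n : nat) (f w : 'rV[F]_n) : F :=
  \sum_(i < n) f 0 i * w 0 i.

Definition form (F : fieldType) (n : nat) (x y : V F n) : F :=
  2%:R^-1 * (pairing (rsubmx x) (lsubmx y) + pairing (rsubmx y) (lsubmx x)).

Definition rho (F : fieldType) (n : nat) (x : V F n) (s : ext F n) : ext F n :=
  wedge (lsubmx x) s + contract (rsubmx x) s.

(* Over an algebraically closed field, Spin(V) is the group of products of an
   even number of vectors x with <x, x> = 1 in the Clifford algebra; the latter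
   is represented faithfully on the exterior algebra of W by rho, hence
   elements of Spin(V) are identified with their actions. *)
Definition spin (F : fieldType) (n : nat) (g : ext F n -> ext F n) : Prop :=
  exists xs : seq (V F n),
    [/\ ~~ odd (size xs), {in xs, forall x, form x x = 1}
      & forall s, g s = foldr (@rho F n) s xs].

(* A is the action of g on V, i.e. A x = g x g^-1 in the Clifford algebra. *)
Definition spin_vector (F : fieldType) (n : nat) (g : ext F n -> ext F n)
    (A : V F n -> V F n) : Prop :=
  forall x s, rho (A x) (g s) = g (rho x s).

Definition halfspin (F : fieldType) (n : nat) (b : bool) : {vspace ext F n} :=
  <<[seq vb F J | J : {set 'I_n} <- enum {set 'I_n} & odd #|J| == b]>>%VS.

Definition Splus (F : fieldType) (n : nat) := halfspin F n false.
Definition Sminus (F : fieldType) (n : nat) := halfspin F n true.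

Definition ext2 (F : fieldType) (n : nat) :=
  {ffun {set 'I_n} * {set 'I_n} -> F^o}.

Definition tens (F : fieldType) (n : nat) (p q : ext F n) : ext2 F n :=
  [ffun JK => (p JK.1 : F) * q JK.2].

Definition tensv (F : fieldType) (n : nat) (P Q : {vspace ext F n}) :
    {vspace ext2 F n} :=
  <<[seq tens p q | p <- vbasis P, q <- vbasis Q]>>%VS.

Definition tensmap (F : fieldType) (n : nat) (g h : ext F n -> ext F n)
    (T : ext2 F n) : ext2 F n :=
  \sum_(J : {set 'I_n}) \sum_(K : {set 'I_n})
     (T (J, K) : F) *: tens (g (vb F J)) (h (vb F K)).

(* phi restricted to the (n-1)-st exterior power of V is a Spin(V)-equivariant
   injection into S_+ (x) S_-; its values elsewhere are irrelevant. *)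
Definition equivariant_inclusion (F : fieldType) (n : nat)
    (phi : 'Hom(ext F (n + n), ext2 F n)) : Prop :=
  let U := extpow F (n + n) n.-1 in
  [/\ (phi @: U <= tensv (Splus F n) (Sminus F n))%VS,
      {in U &, injective phi}
    & forall g A, spin g -> spin_vector g A ->
        {in U, forall w, phi (extmap A w) = tensmap g g (phi w)}].

(* The projective space of a vector space U, as the set of lines in U. *)
Definition proj (F : fieldType) (vT : vectType F) (U : {vspace vT}) :
    set {vspace vT} :=
  fun L => (L <= U)%VS /\ \dim L = 1%N.

Definition projS (F : fieldType) (n : nat) :
    set ({vspace ext F n} * {vspace ext F n}) :=
  fun PQ => proj (Splus F n) PQ.1 /\ proj (Sminus F n) PQ.2.

Definition segre (F : fieldType) (n : nat)
    (PQ : {vspace ext F n} * {vspace ext F n}) : {vspace ext2 F n} :=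
  tensv PQ.1 PQ.2.

(* Polynomials in the coordinates x_J; the variable number i is x_(enum_val i).
   Bidegrees are with respect to the even and the odd coordinates. *)
Definition coordpoly (F : fieldType) (n : nat) := {mpoly F[#|{set 'I_n}|]}.

Definition bihomog (F : fieldType) (n a b : nat) (f : coordpoly F n) : Prop :=
  forall m, m \in msupp f ->
    (\sum_(i | ~~ odd #|enum_val i : {set 'I_n}|) m i = a)%N /\
    (\sum_(i | odd #|enum_val i : {set 'I_n}|) m i = b)%N.

Definition vanishes (F : fieldType) (n : nat) (f : coordpoly F n)
    (PQ : {vspace ext F n} * {vspace ext F n}) : Prop :=
  forall p q, p \in PQ.1 -> q \in PQ.2 ->
    f.@[fun i => (p + q) (enum_val i)] = 0.

(* Zariski-closed subsets and closure in P(S_+) x P(S_-). *)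
Definition zclosed (F : fieldType) (n : nat)
    (Z : set ({vspace ext F n} * {vspace ext F n})) : Prop :=
  exists2 E : set (coordpoly F n),
    forall f, E f -> exists a b, bihomog a b f
    & forall PQ, Z PQ <-> projS PQ /\ forall f, E f -> vanishes f PQ.

Definition zclosure (F : fieldType) (n : nat)
    (A : set ({vspace ext F n} * {vspace ext F n})) :
    set ({vspace ext F n} * {vspace ext F n}) :=
  fun PQ => forall Z, zclosed Z -> (forall x, A x -> Z x) -> Z PQ.

Definition Y0 (F : fieldType) (n : nat) : set (ext F n) := fun x =>
  (forall J, x J != 0) /\
  forall (j k l : 'I_n) (I : {set 'I_n}), (j < k < l)%N ->
    j \notin I -> k \notin I -> l \notin I ->
    (x I : F) * x (j |: (k |: (l |: I))) + (x (j |: (l |: I)) : F) * x (k |: I)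
    = (x (j |: (k |: I)) : F) * x (l |: I)
      + (x (k |: (l |: I)) : F) * x (j |: I).

Definition parity_part (F : fieldType) (n : nat) (b : bool) (x : ext F n) :
    ext F n :=
  [ffun J : {set 'I_n} => if odd #|J| == b then x J else 0].

(* The quotient of Y0 by the two scalings, inside P(S_+) x P(S_-). *)
Definition X0 (F : fieldType) (n : nat) :
    set ({vspace ext F n} * {vspace ext F n}) := fun PQ =>
  exists2 x, Y0 x & PQ = (<[parity_part false x]>%VS, <[parity_part true x]>%VS).

Definition X (F : fieldType) (n : nat) := zclosure (@X0 F n).

Definition IG (F : fieldType) (n : nat) : set {vspace V F n} := fun L =>
  \dim L = n.-1 /\ {in L &, forall x y, form x y = 0}.

Definition plucker (F : fieldType) (d : nat) (L : {vspace 'rV[F]_d}) :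
    {vspace ext F d} :=
  <[wedges (vbasis L)]>%VS.

Definition IG_embedding (F : fieldType) (n : nat)
    (phi : 'Hom(ext F (n + n), ext2 F n)) (L : {vspace V F n}) :
    {vspace ext2 F n} :=
  (phi @: plucker L)%VS.

(* Main.v *)
Require Import Defs.
From HB Require Import structures.
From mathcomp Require Import classical_sets reals.
From mathcomp Require Import all_boot all_order all_algebra.
From mathcomp Require Import mpoly complex.
From mathcomp Require Import ring.

(** Let Omega = sum_k e_k (x) e_k^* act on S (x) S through the Clifford action, k
    ranging over a basis of V.  Call two spinors p and q incident if
    Omega (p (x) q) = q (x) p; incidence is invariant under the Clifford action
    of every vector.  An isotropic L of dimension n - 1 annihilates exactly one
    line in each half-spin representation.  For L = span(e_i^* : i <> i0) these
    lines are spanned by 1 and e_i0, which are incident; by Witt's theorem Spin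
    moves this L to any other.  Conversely, contracting the incidence equation of
    (p, q) with the coordinates of index J + e_k, where p_J <> 0, produces an
    isotropic subspace of dimension n - 1 that annihilates p and q.  So the closed
    set of pairs of incident lines in S_+ and S_- is a single Spin-orbit.  Torus
    weights show that an equivariant inclusion maps the wedge of the e_i^*,
    i <> i0, to a multiple of 1 (x) e_i0, whence this orbit is the image of
    IG(n-1, 2n).

    The cube equations are coordinates of the incidence equation.  Conversely, a
    solution without zero coordinates is determined by its coordinates of degree
    at most 2, and exp(w) (1, u), for suitable w in the second exterior power of W
    and u in W, is an incident pair with the same ones.  Hence the open set lies
    in the orbit.  It is dense there: the all-ones vector is a solution, so on a
    line of words in V that joins an arbitrary product of unit vectors to one
    producing the all-ones vector, almost every word gives a solution without zero
    coordinates. *)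

Set Implicit Arguments.
Unset Strict Implicit.
Unset Printing Implicit Defensive.

Import Defs GRing.Theory Num.Theory.

Local Open Scope ring_scope.

Section Flip.

Variables (F : fieldType) (d : nat).
Implicit Types (i j k : 'I_d) (K : {set 'I_d}).

Definition flip j K : {set 'I_d} := if j \in K then K :\ j else j |: K.

Lemma in_flip i j K : (i \in flip j K) = (i \in K) (+) (i == j).
Proof.
by rewrite /flip; case: ifP => jK; rewrite !inE; case: eqP => [->|_] //=;
  rewrite ?jK ?addbF.
Qed.

Lemma flipK j : involutive (flip j).
Proof. by move=> K; apply/setP=> i; rewrite !in_flip -addbA addbb addbF. Qed.

Lemma flipC i j K : flip i (flip j K) = flip j (flip i K).
Proof. by apply/setP=> k; rewrite !in_flip -!addbA [X in _ (+) X]addbC. Qed.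

Lemma flip_in j K : j \in K -> flip j K = K :\ j.
Proof. by rewrite /flip => ->. Qed.

Lemma flip_notin j K : j \notin K -> flip j K = j |: K.
Proof. by rewrite /flip => /negPf->. Qed.

Lemma flip_eq0 j K : (flip j K == set0) = (K == [set j]).
Proof.
by rewrite -[set0](flipK j) (can_eq (flipK j)) flip_notin ?inE // setU0.
Qed.

Lemma in_foldr_flip i (js : seq 'I_d) K :
  uniq js -> (i \in foldr flip K js) = (i \in js) (+) (i \in K).
Proof.
elim: js => //= j js IH /andP[jjs /IH {}IH]; rewrite in_flip IH inE.
have [->|_] := eqVneq i j; last by rewrite addbF.
by rewrite (negPf jjs) addbC.
Qed.

Lemma odd_flip j K : odd #|flip j K| = ~~ odd #|K|.
Proof.
rewrite /flip; case: ifP => jK; last by rewrite cardsU1 jK.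
by rewrite (cardsD1 j K) jK /= negbK.
Qed.

Lemma sgnE j K : sgn F j K = \prod_(k < d) (-1) ^+ ((k \in K) && (k < j)%N).
Proof.
rewrite /sgn -prodr_const big_mkcond /=; apply: eq_bigr => k _.
by rewrite unfold_in /=; case: (_ && _).
Qed.

Lemma sgn_set0 j : sgn F j set0 = 1.
Proof. by rewrite sgnE big1 // => k _; rewrite inE. Qed.

Lemma sgn_sqr j K : sgn F j K * sgn F j K = 1.
Proof. by rewrite /sgn -expr2 sqrr_sign. Qed.

Lemma sgn_neq0 j K : sgn F j K != 0.
Proof. by rewrite /sgn signr_eq0. Qed.

Lemma sgn_flip i j K : sgn F i (flip j K) = (-1) ^+ (j < i)%N * sgn F i K.
Proof.
rewrite !sgnE (bigD1 j) //= [in RHS](bigD1 j) //= mulrA; congr (_ * _).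
  rewrite in_flip eqxx addbT.
  by case: (j \in K); case: (j < i)%N; rewrite /= ?expr0 ?expr1 ?mulrNN ?mulr1.
by apply: eq_bigr => k /negPf kj; rewrite in_flip kj addbF.
Qed.

Lemma sgn_flip_id j K : sgn F j (flip j K) = sgn F j K.
Proof. by rewrite sgn_flip ltnn expr0 mul1r. Qed.

Lemma sgn_mul_flip i j K : sgn F i K * sgn F i (flip j K) = (-1) ^+ (j < i)%N.
Proof. by rewrite sgn_flip mulrCA sgn_sqr mulr1. Qed.

Lemma sign_ltn_anti i j : i != j -> (-1) ^+ (i < j)%N = - (-1) ^+ (j < i)%N :> F.
Proof.
rewrite -val_eqE neq_ltn => /orP[] ij; rewrite ij ltnNge (ltnW ij) //=.
by rewrite opprK.
Qed.

Lemma sgn_flip_anticomm i j K : i != j ->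
  sgn F i K * sgn F j (flip i K) = - (sgn F j K * sgn F i (flip j K)).
Proof. by move=> ij; rewrite !sgn_flip (sign_ltn_anti ij); ring. Qed.

End Flip.

Lemma enum_ord_sorted (d : nat) (K : {set 'I_d}) :
  sorted (relpre val ltn) (enum K).
Proof.
rewrite /enum_mem -enumT; apply: sorted_filter => [i j k|].
  exact: ltn_trans.
by rewrite -sorted_map val_enum_ord iota_ltn_sorted.
Qed.

Lemma ltn_ord_neq3 (d : nat) (j k l : 'I_d) :
  (j < k < l)%N -> [/\ j != k, k != l & j != l].
Proof.
by case/andP=> jk kl; rewrite -!val_eqE /= !neq_ltn jk kl (ltn_trans jk kl).
Qed.

Lemma set_card_gt2_sorted (d : nat) (J : {set 'I_d}) : (2 < #|J|)%N ->
  exists (j k l : 'I_d) (I : {set 'I_d}),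
    [/\ (j < k < l)%N, j \notin I, k \notin I, l \notin I
      & J = j |: (k |: (l |: I))].
Proof.
move=> J2; have := mem_enum J; move: J2 (enum_ord_sorted J) (enum_uniq J).
rewrite cardE; case: (enum J) => [|j [|k [|l s]]] //= _.
case/and3P=> jk kl _ /and4P[js ks ls _] JE.
exists j, k, l, [set i in s]; split; last by apply/setP=> i; rewrite -JE !inE.
- by rewrite jk.
- by move: js; rewrite !inE !negb_or => /and3P[].
- by move: ks; rewrite !inE !negb_or => /andP[].
- by rewrite inE.
Qed.

Section Basis.

Variables (F : fieldType) (d : nat).
Implicit Types (s : ext F d) (K : {set 'I_d}).

Lemma vb_sum s : s = \sum_J (s J : F) *: vb F J.
Proof.
apply/ffunP=> K; rewrite sum_ffunE (bigD1 K) //= !ffunE eqxx big1 => [|J JK].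
  by rewrite addr0 /GRing.scale /= mulr1.
by rewrite !ffunE eq_sym (negPf JK) scaler0.
Qed.

Lemma vb_neq0 K : vb F K != 0.
Proof. by apply/eqP=> /ffunP/(_ K)/eqP; rewrite !ffunE eqxx oner_eq0. Qed.

Lemma ext_neq0P s : reflect (exists K, s K != 0) (s != 0).
Proof.
apply: (iffP idP) => [sN0|[K]]; last by apply: contraNneq => ->; rewrite ffunE.
apply/existsP; apply: contraNT sN0; rewrite negb_exists => /forallP s0.
by apply/eqP/ffunP=> K; rewrite ffunE; apply/eqP/negbNE/s0.
Qed.

Lemma wedge_is_bilinear : bilinear_for *:%R *:%R (@wedge F d).
Proof.
split=> [s|u] r x y; apply/ffunP=> K;
  rewrite !ffunE scaler_sumr -big_split; apply: eq_bigr => j _ /=.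
  by rewrite !mxE /GRing.scale /=; ring.
by rewrite !ffunE /GRing.scale /=; ring.
Qed.
HB.instance Definition _ := bilinear_isBilinear.Build F 'rV[F]_d (ext F d)
  (ext F d) *:%R *:%R (@wedge F d) wedge_is_bilinear.

Lemma wedges_scale (I : Type) (c : I -> F) (f : I -> 'rV[F]_d) (ks : seq I) :
  wedges [seq c k *: f k | k <- ks] =
  (\prod_(k <- ks) c k) *: wedges [seq f k | k <- ks].
Proof.
elim: ks => [|k ks IH] /=; first by rewrite big_nil scale1r.
by rewrite big_cons -/(wedges _) IH linearZl_LR linearZr_LR /= scalerA.
Qed.

Lemma wedge_eb_vb (j : 'I_d) K : {in K, forall k : 'I_d, (j < k)%N} ->
  wedge (eb F j) (vb F K) = vb F (j |: K).
Proof.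
move=> jK; have jNK : j \notin K by apply/negP=> /jK; rewrite ltnn.
apply/ffunP=> L; rewrite !ffunE.
have [jL|jNL] := boolP (j \in L); last first.
  have /negPf-> : L != j |: K by apply: contraNneq jNL => ->; rewrite setU11.
  apply: big1 => i iL; have /negPf ij : i != j by apply: contraNneq jNL => <-.
  by rewrite mxE ij andbF mulr0 mul0r.
rewrite (bigD1 j) //= big1 => [|i /andP[_ /negPf ij]]; last first.
  by rewrite mxE ij andbF mulr0 mul0r.
rewrite mxE !eqxx mulr1 addr0 ffunE.
have [E|E] := eqVneq (L :\ j) K.
  rewrite -(setD1K jL) E eqxx mulr1 -flip_notin // sgn_flip_id.
  rewrite /sgn (_ : #|_| = 0%N) //; apply: eq_card0 => k; rewrite !inE.
  by apply/andP=> -[/jK jk kj]; rewrite ltnNge ltnW in jk.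
have /negPf-> : L != j |: K by apply: contraNneq E => ->; rewrite setU1K.
by rewrite mulr0.
Qed.

Lemma wedges_eb K : wedges [seq eb F k | k <- enum K] = vb F K.
Proof.
have KE : K = [set k in enum K] by apply/setP=> k; rewrite inE mem_enum.
rewrite [in RHS]KE; move: (enum_ord_sorted K) => {KE}.
elim: (enum K) => [|k ks IH] /=.
  by move=> _; congr (vb _ _); apply/setP=> i; rewrite !inE.
rewrite path_sortedE => [/andP[/allP kks /IH IHks]|]; last first.
  by move=> i j l; apply: ltn_trans.
rewrite -/(wedges _) IHks wedge_eb_vb => [|i]; last by rewrite inE => /kks.
by congr (vb _ _); apply/setP=> i; rewrite !inE.
Qed.

Lemma extmap_vb (A : 'rV[F]_d -> 'rV[F]_d) K :
  extmap A (vb F K) = wedges [seq A (eb F k) | k <- enum K].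
Proof.
rewrite /extmap (bigD1 K) //= ffunE eqxx scale1r big1 ?addr0 // => J JK.
by rewrite ffunE (negPf JK) scale0r.
Qed.

End Basis.

Section DualIndex.

Variable n : nat.
Implicit Types (i j : 'I_n) (k : 'I_(n + n)) (K : {set 'I_n}).

(* e_(dual k) is, up to the factor 2, dual to e_k for the form of V. *)
Definition dual k : 'I_(n + n) :=
  match split k with inl i => rshift n i | inr i => lshift n i end.

Lemma dual_lshift i : dual (lshift n i) = rshift n i.
Proof. by rewrite /dual (unsplitK (inl i)). Qed.

Lemma dual_rshift i : dual (rshift n i) = lshift n i.
Proof. by rewrite /dual (unsplitK (inr i)). Qed.

Lemma dualK : involutive dual.
Proof.
by move=> k; case: (split_ordP k) => i ->; rewrite !(dual_lshift, dual_rshift).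
Qed.

(* The index of the basis vector of V that maps v_(flip j K) to +- v_K. *)
Definition slot j K : 'I_(n + n) := if j \in K then lshift n j else rshift n j.

Lemma eq_slot i j K : (slot i K == slot j K) = (i == j).
Proof.
apply/eqP/eqP=> [|->] //; rewrite /slot.
by case: ifP; case: ifP => _ _ /eqP;
  rewrite ?eq_lshift ?eq_rshift ?eq_lrshift ?eq_rlshift // => /eqP.
Qed.

Lemma slot_neq_dual i j K : (slot i K == dual (slot j K)) = false.
Proof.
rewrite /slot; case iK: (i \in K); case jK: (j \in K);
  rewrite ?dual_lshift ?dual_rshift ?eq_lrshift ?eq_rlshift //;
  rewrite ?eq_lshift ?eq_rshift; by apply/eqP=> ij; rewrite ij jK in iK.
Qed.

Lemma slot_flip i j K :
  slot i (flip j K) = if i == j then dual (slot i K) else slot i K.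
Proof.
rewrite /slot in_flip; case: eqP => _; last by rewrite addbF.
by case: (i \in K); rewrite ?dual_lshift ?dual_rshift.
Qed.

Lemma sum_slot (R : nmodType) (f : 'I_(n + n) -> R) K :
  \sum_k f k = \sum_j (f (slot j K) + f (dual (slot j K))).
Proof.
rewrite big_split_ord /= -big_split; apply: eq_bigr => j _ /=; rewrite /slot.
by case: ifP; rewrite ?dual_lshift ?dual_rshift // addrC.
Qed.

End DualIndex.

Section Clifford.

Variables (F : fieldType) (n : nat).
Implicit Types (i j : 'I_n) (k : 'I_(n + n)) (K : {set 'I_n}).
Implicit Types (s : ext F n) (x : V F n).

Lemma rho_coord x s K :
  rho x s K = \sum_j sgn F j K * x 0 (slot j K) * s (flip j K) :> F.
Proof.
rewrite /rho !ffunE (bigID (mem K) predT) /=; congr (_ + _).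
  by apply: eq_bigr => j jK; rewrite mxE /slot jK flip_in.
by apply: eq_bigr => j jK; rewrite mxE /slot (negPf jK) flip_notin.
Qed.

Lemma rho_is_bilinear : bilinear_for *:%R *:%R (@rho F n).
Proof.
split=> [s|x] r u v; apply/ffunP=> K.
  transitivity (r *: (rho u s K) + rho v s K); last by rewrite !ffunE.
  rewrite !rho_coord scaler_sumr -big_split; apply: eq_bigr => j _ /=.
  by rewrite !mxE /GRing.scale /=; ring.
transitivity (r *: (rho x u K) + rho x v K); last by rewrite !ffunE.
rewrite !rho_coord scaler_sumr -big_split; apply: eq_bigr => j _ /=.
by rewrite !ffunE /GRing.scale /=; ring.
Qed.
HB.instance Definition _ := bilinear_isBilinear.Build F (V F n) (ext F n)
  (ext F n) *:%R *:%R (@rho F n) rho_is_bilinear.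
HB.instance Definition _ x :=
  GRing.isLinear.Build F (ext F n) (ext F n) _ (rho x) (rho_is_bilinear.2 x).

Lemma rhoE x s : rho x s = \sum_k x 0 k *: rho (eb F k) s.
Proof.
rewrite {1}(row_sum_delta x) linear_sumlz; apply: eq_bigr => k _.
by rewrite linearZl_LR.
Qed.

Lemma rho_eb_slot j K s : rho (eb F (slot j K)) s K = sgn F j K * s (flip j K).
Proof.
rewrite rho_coord (bigD1 j) //= big1 => [|i /negPf ij].
  by rewrite mxE !eqxx mulr1 addr0.
by rewrite mxE eq_slot ij andbF mulr0 mul0r.
Qed.

Lemma rho_eb_dual_slot j K s : rho (eb F (dual (slot j K))) s K = 0.
Proof.
rewrite rho_coord big1 // => i _.
by rewrite mxE slot_neq_dual andbF mulr0 mul0r.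
Qed.

Lemma rho_lshift i s K : rho (eb F (lshift n i)) s K =
  if i \in K then sgn F i K * s (flip i K) else 0.
Proof.
case: ifPn => iK.
  by rewrite (_ : lshift n i = slot i K) ?rho_eb_slot // /slot iK.
rewrite (_ : lshift n i = dual (slot i K)) ?rho_eb_dual_slot //.
by rewrite /slot (negPf iK) dual_rshift.
Qed.

Lemma rho_rshift i s K : rho (eb F (rshift n i)) s K =
  if i \in K then 0 else sgn F i K * s (flip i K).
Proof.
case: ifPn => iK; last first.
  by rewrite (_ : rshift n i = slot i K) ?rho_eb_slot // /slot (negPf iK).
rewrite (_ : rshift n i = dual (slot i K)) ?rho_eb_dual_slot //.
by rewrite /slot iK dual_lshift.
Qed.

End Clifford.

Section Form.

Variables (F : numFieldType) (n : nat).
Implicit Types (k l : 'I_(n + n)).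
Implicit Types (s : ext F n) (x y : V F n).

Lemma formE x y : form x y = 2%:R^-1 * \sum_k x 0 k * y 0 (dual k).
Proof.
rewrite /form /pairing big_split_ord /= addrC; congr (_ * (_ + _));
  by apply: eq_bigr => i _; rewrite ?dual_lshift ?dual_rshift !mxE // mulrC.
Qed.

Lemma form_mul2n x y : form x y *+ 2 = \sum_k x 0 k * y 0 (dual k).
Proof.
by rewrite formE -mulrnAl -[_ *+ 2]mulr_natr mulVf ?pnatr_eq0 // mul1r.
Qed.

Lemma formC x y : form x y = form y x.
Proof. by rewrite /form addrC. Qed.

Lemma form_is_bilinear : bilinear_for *%R *%R (@form F n).
Proof.
suff lin_form y : scalar (form y).
  by split=> [y|//] r x z; rewrite ![form _ y]formC lin_form.
move=> r x z; rewrite /= !formE mulrCA -mulrDr; congr (_ * _).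
rewrite mulr_sumr -big_split; apply: eq_bigr => k _ /=.
by rewrite !mxE; ring.
Qed.
HB.instance Definition _ := bilinear_isBilinear.Build F (V F n) (V F n) F
  *%R *%R (@form F n) form_is_bilinear.

Lemma form_ebl k x : form (eb F k) x = 2%:R^-1 * x 0 (dual k).
Proof.
rewrite formE (bigD1 k) //= mxE !eqxx mul1r big1 ?addr0 // => l /negPf lk.
by rewrite mxE lk andbF mul0r.
Qed.

Lemma form_eb k l : form (eb F k) (eb F l) = 2%:R^-1 * (dual k == l)%:R.
Proof. by rewrite form_ebl mxE eqxx. Qed.

Lemma rho_anticomm x y s :
  rho x (rho y s) + rho y (rho x s) = (form x y *+ 2) *: s.
Proof.
(* The terms of indices (i, j) and (j, i) cancel when i <> j. *)
apply/ffunP=> K; rewrite ffunE !rho_coord.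
under eq_bigr do rewrite rho_coord mulr_sumr.
under [X in _ + X]eq_bigr do rewrite rho_coord mulr_sumr.
rewrite [X in _ + X]exchange_big -big_split /= ffunE form_mul2n (sum_slot _ K).
rewrite scaler_suml; apply: eq_bigr => i _ /=.
rewrite -big_split /= (bigD1 i) //=.
rewrite [X in _ + X]big1 => [|j ji].
  rewrite addr0 slot_flip eqxx flipK sgn_flip_id dualK /GRing.scale /=.
  by rewrite -[RHS]mul1r -(sgn_sqr F i K); ring.
rewrite (flipC i j) !slot_flip (negPf ji) eq_sym (negPf ji).
transitivity ((sgn F i K * sgn F j (flip i K) + sgn F j K * sgn F i (flip j K))
    * (x 0 (slot i K) * y 0 (slot j K) * s (flip j (flip i K)))); first by ring.
by rewrite (sgn_flip_anticomm F K ji) addrN mul0r.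
Qed.

Lemma rho_sqr x s : rho x (rho x s) = form x x *: s.
Proof.
have two_neq0 : 2%:R != 0 :> F by rewrite pnatr_eq0.
apply: (scalerI two_neq0).
by rewrite scaler_nat mulr2n rho_anticomm scalerA mulr_natl.
Qed.

Lemma rho_unitK x : form x x = 1 -> involutive (rho x).
Proof. by move=> x1 s; rewrite rho_sqr x1 scale1r. Qed.

Lemma rho_eb_rho k x s :
  rho (eb F k) (rho x s) = x 0 (dual k) *: s - rho x (rho (eb F k) s).
Proof.
apply/eqP; rewrite eq_sym subr_eq eq_sym rho_anticomm form_ebl -mulrnAl.
by rewrite -[_ *+ 2]mulr_natr mulVf ?pnatr_eq0 // mul1r.
Qed.

End Form.

Section Tensor.

Variables (F : fieldType) (n : nat).
Implicit Types (p q : ext F n) (T : ext2 F n) (P Q : {vspace ext F n}).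
Implicit Types (J K : {set 'I_n}).

Lemma tens_is_bilinear : bilinear_for *:%R *:%R (@tens F n).
Proof.
by split=> s r p q; apply/ffunP=> J; rewrite !ffunE /GRing.scale /=; ring.
Qed.
HB.instance Definition _ := bilinear_isBilinear.Build F (ext F n) (ext F n)
  (ext2 F n) *:%R *:%R (@tens F n) tens_is_bilinear.

Lemma tens_vb_sum T : T = \sum_J \sum_K (T (J, K) : F) *: tens (vb F J) (vb F K).
Proof.
rewrite pair_bigA; apply/ffunP=> -[J K] /=.
rewrite sum_ffunE (bigD1 (J, K)) //= !ffunE /= !eqxx big1 => [|[L M] LM].
  by rewrite addr0 /GRing.scale /= !mulr1.
by rewrite !ffunE -natrM mulnb -xpair_eqE eq_sym (negPf LM) scaler0.
Qed.

Lemma tensmap_is_linear (g h : ext F n -> ext F n) : linear (tensmap g h).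
Proof.
move=> r T U; rewrite /tensmap scaler_sumr -big_split; apply: eq_bigr => J _ /=.
rewrite scaler_sumr -big_split; apply: eq_bigr => K _ /=.
by rewrite !ffunE scalerDl scalerA.
Qed.
HB.instance Definition _ g h :=
  GRing.isLinear.Build F (ext2 F n) (ext2 F n) _ (tensmap g h)
    (tensmap_is_linear g h).

Lemma tensmap_tens (g h : {linear ext F n -> ext F n}) p q :
  tensmap g h (tens p q) = tens (g p) (h q).
Proof.
rewrite [in RHS](vb_sum p) [in RHS](vb_sum q) !linear_sum linear_sumlz.
apply: eq_bigr => J _ /=; rewrite linear_sumr; apply: eq_bigr => K _ /=.
by rewrite !ffunE !linearZ /= linearZl_LR linearZr_LR /= scalerA.
Qed.

Lemma tensmap_diag (g h : ext F n -> ext F n) (c e : {set 'I_n} -> F) T J K :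
    (forall I, g (vb F I) = c I *: vb F I) ->
    (forall I, h (vb F I) = e I *: vb F I) ->
  tensmap g h T (J, K) = c J * e K * T (J, K).
Proof.
move=> gE hE; pose T' : ext2 F n := [ffun IM => c IM.1 * e IM.2 * T IM].
have -> : tensmap g h T = T'; last by rewrite ffunE.
rewrite [RHS]tens_vb_sum; apply: eq_bigr => I _; apply: eq_bigr => M _.
rewrite ffunE gE hE linearZl_LR linearZr_LR /= !scalerA.
by congr (_ *: _) => /=; ring.
Qed.

Lemma mem_tensv P Q p q : p \in P -> q \in Q -> tens p q \in tensv P Q.
Proof.
move=> pP qQ; rewrite (coord_vbasis pP) (coord_vbasis qQ) linear_sumlz.
apply: memv_suml => i _; rewrite linear_sumr; apply: memv_suml => j _.
rewrite linearZl_LR linearZr_LR; do 2!apply: memvZ; apply: memv_span.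
apply/allpairsP; exists ((vbasis P)`_i, (vbasis Q)`_j).
by rewrite /= !mem_nth ?size_tuple.
Qed.

Lemma tensv_line p q : tensv <[p]> <[q]> = <[tens p q]>%VS.
Proof.
apply/eqP; rewrite eqEsubv -memvE mem_tensv ?memv_line // andbT.
apply/span_subvP=> w /allpairsP[[p' q'] /= [pP qQ ->]].
have /vlineP[r ->] := vbasis_mem pP; have /vlineP[t ->] := vbasis_mem qQ.
by rewrite linearZl_LR linearZr_LR !memvZ ?memv_line.
Qed.

Lemma tens_mem_line p q p' q' : p != 0 -> q != 0 ->
  tens p q \in <[tens p' q']>%VS -> p \in <[p']>%VS /\ q \in <[q']>%VS.
Proof.
move=> /ext_neq0P[J pJ] /ext_neq0P[K qK] /vlineP[r /ffunP pqE].
split; apply/vlineP.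
  exists (r * q' K / q K); apply/ffunP=> I; have := pqE (I, K).
  by rewrite !ffunE /GRing.scale /= => E; apply: (mulIf qK); rewrite E; field.
exists (r * p' J / p J); apply/ffunP=> I; have := pqE (J, I).
by rewrite !ffunE /GRing.scale /= => E; apply: (mulfI pJ); rewrite E; field.
Qed.

End Tensor.

Section Parity.

Variables (F : fieldType) (n : nat).
Implicit Types (s p q : ext F n) (x : V F n) (J K : {set 'I_n}) (b : bool).

Lemma parity_part_is_linear b : linear (@parity_part F n b).
Proof.
move=> r s t; apply/ffunP=> J; rewrite !ffunE.
by case: ifP; rewrite ?scaler0 ?addr0.
Qed.
HB.instance Definition _ b := GRing.isLinear.Build F (ext F n) (ext F n) _
  (@parity_part F n b) (parity_part_is_linear b).

Lemma parity_part_vb b J :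
  parity_part b (vb F J) = (odd #|J| == b)%:R *: vb F J.
Proof.
apply/ffunP=> K; rewrite !ffunE; have [->|_] := eqVneq K J.
  by case: ifP; rewrite ?scale1r ?scale0r.
by rewrite if_same scaler0.
Qed.

Lemma parity_partD s : parity_part false s + parity_part true s = s.
Proof.
by apply/ffunP=> J; rewrite !ffunE; case: (odd _); rewrite ?addr0 ?add0r.
Qed.

Lemma parity_part_add b p q :
  parity_part b (parity_part false p + parity_part true q)
  = parity_part b (if b then q else p).
Proof.
apply/ffunP=> J; rewrite !ffunE.
by case: b; case: (odd _); rewrite /= ?addr0 ?add0r.
Qed.

Lemma rho_parity_part x b s :
  rho x (parity_part b s) = parity_part (~~ b) (rho x s).
Proof.
apply/ffunP=> K; rewrite [RHS]ffunE !rho_coord; case: ifP => oK.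
  apply: eq_bigr => j _; rewrite ffunE odd_flip.
  by case: (odd _) b oK => [] [].
rewrite big1 // => j _; rewrite ffunE odd_flip.
by case: (odd _) b oK => [] []; rewrite ?mulr0.
Qed.

Lemma rho_parity_part_eq0 x s :
  rho x s = 0 <-> forall b, rho x (parity_part b s) = 0.
Proof.
split=> [xs b|xs]; first by rewrite rho_parity_part xs linear0.
by rewrite -(parity_partD s) linearDr /= !xs addr0.
Qed.

Lemma halfspinP b s : reflect (parity_part b s = s) (s \in halfspin F n b).
Proof.
apply: (iffP idP) => [sb|<-].
  have /subvP/(_ s sb)/fixedSpaceP : (halfspin F n b <=
      fixedSpace (linfun (@parity_part F n b)))%VS; last by rewrite lfunE.
  apply/span_subvP=> _ /mapP[K + ->]; rewrite mem_filter => /andP[Kb _].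
  by apply/fixedSpaceP; rewrite lfunE /= parity_part_vb Kb scale1r.
rewrite (vb_sum s) linear_sum; apply: memv_suml => J _.
rewrite linearZ /= parity_part_vb; apply/memvZ; case: eqP => Jb.
  rewrite scale1r; apply/memv_span/map_f.
  by rewrite mem_filter Jb eqxx mem_enum.
by rewrite scale0r mem0v.
Qed.

Lemma parity_part_halfspin b s : parity_part b s \in halfspin F n b.
Proof. by apply/halfspinP/ffunP=> J; rewrite !ffunE; case: (_ == b). Qed.

Lemma tensv_halfspin_coord b c (T : ext2 F n) J K :
    T \in tensv (halfspin F n b) (halfspin F n c) ->
  (odd #|J| != b) || (odd #|K| != c) -> T (J, K) = 0.
Proof.
move=> TS; have {TS} : tensmap (parity_part b) (parity_part c) T = T.
  rewrite -[LHS]lfunE; apply/fixedSpaceP; apply: subvP TS.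
  apply/span_subvP=> _ /allpairsP[[p q] /= [pP qQ ->]]; apply/fixedSpaceP.
  by rewrite lfunE /= tensmap_tens; congr (tens _ _); apply/halfspinP/vbasis_mem.
move=> <-; rewrite (tensmap_diag _ _ _ (parity_part_vb b) (parity_part_vb c)).
by case: eqP => _; case: eqP => _; rewrite ?mulr0 ?mul0r.
Qed.

End Parity.

Section Incidence.

Variables (F : fieldType) (n : nat).
Implicit Types (p q : ext F n) (J K : {set 'I_n}).

Definition omega p q : ext2 F n :=
  \sum_k tens (rho (eb F k) p) (rho (eb F (dual k)) q).

(* The equations of the pairs of pure spinors whose annihilators in V meet in
   dimension n - 1. *)
Definition incident p q := omega p q = tens q p.

Lemma omega_coord p q J K : omega p q (J, K) =
  \sum_(j | (j \in J) != (j \in K))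
    sgn F j J * sgn F j K * ((p (flip j J) : F) * q (flip j K)).
Proof.
rewrite /omega (sum_slot _ J) sum_ffunE [RHS]big_mkcond /=.
apply: eq_bigr => j _.
rewrite [LHS]ffunE dualK [X in _ + X]ffunE rho_eb_dual_slot mul0r addr0.
rewrite [LHS]ffunE /= rho_eb_slot; have [jK|jNK] := eqVneq (j \in J) (j \in K).
  have -> : slot j J = slot j K by rewrite /slot jK.
  by rewrite rho_eb_dual_slot mulr0.
have -> : dual (slot j J) = slot j K.
  by move: jNK; rewrite /slot; case: (j \in J); case: (j \in K);
    rewrite ?dual_lshift ?dual_rshift.
by rewrite rho_eb_slot; ring.
Qed.

Lemma omega_foldr_flip p q (js : seq 'I_n) K (J := foldr (@flip n) K js) :
  uniq js -> omega p q (J, K) = \sum_(j <- js)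
    sgn F j J * sgn F j K * ((p (flip j J) : F) * q (flip j K)).
Proof.
move=> ujs; rewrite omega_coord big_uniq //; apply: eq_bigl => j.
by rewrite in_foldr_flip //; case: (j \in js); case: (j \in K).
Qed.

Lemma omegaC p q J K : omega p q (J, K) = omega q p (K, J).
Proof.
rewrite !omega_coord; under eq_bigl do rewrite eq_sym.
by apply: eq_bigr => j _; ring.
Qed.

Lemma omegaZ (r t : F) p q : omega (r *: p) (t *: q) = (r * t) *: omega p q.
Proof.
rewrite scaler_sumr; apply: eq_bigr => k _.
by rewrite !linearZr_LR linearZl_LR /= scalerA mulrC.
Qed.

Lemma incidentC p q : incident p q -> incident q p.
Proof.
by move=> pq; apply/ffunP=> -[J K]; rewrite omegaC pq !ffunE mulrC.
Qed.

Lemma incidentZ (r t : F) p q : incident p q -> incident (r *: p) (t *: q).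
Proof.
rewrite /incident omegaZ => ->.
by rewrite linearZl_LR linearZr_LR /= scalerA mulrC.
Qed.

Lemma rho_rshift_vac (j : 'I_n) : rho (eb F (rshift n j)) (vb F set0) = 0.
Proof.
apply/ffunP=> K; rewrite [RHS]ffunE rho_rshift; case: ifPn => // jK.
by rewrite ffunE flip_eq0; case: eqP jK => [->|_]; rewrite ?set11 ?mulr0.
Qed.

Lemma omega_vac : omega (vb F set0) (vb F set0) = 0.
Proof.
rewrite /omega big1 // => k _; case: (split_ordP k) => j ->.
  by rewrite dual_lshift rho_rshift_vac linear0r.
by rewrite rho_rshift_vac linear0l.
Qed.

End Incidence.

Section IncidenceEquivariance.

Variables (F : numFieldType) (n : nat).
Implicit Types (p q : ext F n) (x : V F n).

Lemma omega_rho x p q :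
  omega (rho x p) (rho x q) = tensmap (rho x) (rho x) (omega p q).
Proof.
(* Moving x to the left of e_k and of e_k^* produces, besides the right-hand
   side, the terms 2<x, x> - <x, x> - <x, x>. *)
rewrite /omega linear_sum /=; under [RHS]eq_bigr do rewrite tensmap_tens /=.
rewrite (eq_bigr (fun k => x 0 k * x 0 (dual k) *: tens p q
  - x 0 (dual k) *: tens p (rho x (rho (eb F (dual k)) q))
  - x 0 k *: tens (rho x (rho (eb F k) p)) q
  + tens (rho x (rho (eb F k) p)) (rho x (rho (eb F (dual k)) q)))); last first.
  move=> k _; rewrite !rho_eb_rho dualK; move: (rho x _) (rho x _) => p' q'.
  by apply/ffunP=> -[J K]; rewrite !ffunE /GRing.scale /=; ring.
rewrite 3!big_split /= !sumrN -[RHS]add0r; congr (_ + _).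
rewrite -scaler_suml -form_mul2n -(reindex_inj (can_inj (@dualK n)) (P := predT)
  (F := fun k => x 0 k *: tens p (rho x (rho (eb F k) q)))) /=.
under [X in _ - X - _]eq_bigr do rewrite -linearZr_LR -linearZr_LR.
under [X in _ - X]eq_bigr do rewrite -linearZl_LR -linearZr_LR.
rewrite /= -linear_sumlz -linear_sumr -!(linear_sum (rho x)) -!rhoE.
by rewrite /= !rho_sqr linearZl_LR linearZr_LR mulr2n scalerDl addrK subrr.
Qed.

Lemma incident_rho x p q : incident p q -> incident (rho x p) (rho x q).
Proof. by rewrite /incident omega_rho => ->; rewrite tensmap_tens. Qed.

Lemma incident_rho_self p x : omega p p = 0 -> incident p (rho x p).
Proof.
move=> pp; have {pp} : tensmap (@idfun (ext F n)) (rho x) (omega p p) = 0.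
  by rewrite pp linear0.
rewrite linear_sum /=; under eq_bigr do rewrite tensmap_tens /=.
move=> pp; rewrite /incident /omega -[LHS]addr0 -[X in _ + X]pp -big_split.
rewrite [in RHS]rhoE linear_sumlz; apply: eq_bigr => k _ /=.
by rewrite rho_eb_rho dualK linearDr linearNr linearZr_LR linearZl_LR /= subrK.
Qed.

End IncidenceEquivariance.

Section IncidentParts.

Variables (F : fieldType) (n : nat).
Implicit Types (x y : ext F n) (I J K : {set 'I_n}) (j k l : 'I_n).

Definition incident_parts y :=
  incident (parity_part false y) (parity_part true y).

Lemma omega_parity_part y J K :
  omega (parity_part false y) (parity_part true y) (J, K)
  = if odd #|J| && ~~ odd #|K| then omega y y (J, K) else 0.
Proof.
rewrite !omega_coord; case: ifPn => JK; last first.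
  rewrite big1 // => j _; rewrite !ffunE !odd_flip.
  by move: JK; case: (odd _); case: (odd _); rewrite //= ?mul0r !mulr0.
apply: eq_bigr => j _; rewrite !ffunE !odd_flip.
by case/andP: JK => -> /negPf->.
Qed.

Lemma incident_partsP y : incident_parts y <->
  forall J K, odd #|J| -> ~~ odd #|K| -> omega y y (J, K) = (y J : F) * y K.
Proof.
split=> [yy J K oJ oK|yy].
  have /ffunP/(_ (J, K)) := yy.
  by rewrite omega_parity_part oJ oK !ffunE oJ (negPf oK).
apply/ffunP=> -[J K]; rewrite omega_parity_part !ffunE /=.
by case: ifP => [/andP[oJ oK]|]; rewrite ?yy ?oJ ?(negPf oK) //;
  case: (odd _); case: (odd _); rewrite //= ?mul0r ?mulr0.
Qed.

Lemma incident_parts_omega y J K : incident_parts y -> odd #|J| != odd #|K| ->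
  omega y y (J, K) = (y J : F) * y K.
Proof.
move=> /incident_partsP yy; have [oJ|oJ] := boolP (odd #|J|) => oK.
  by apply: yy => //; move: oK; case: (odd _).
by rewrite omegaC mulrC; apply: yy => //; move: oK; case: (odd _).
Qed.

Lemma incident_partsZ (r : F) y : incident_parts y -> incident_parts (r *: y).
Proof. by rewrite /incident_parts !linearZ; apply: incidentZ. Qed.

Definition cube_equations y := forall j k l I, (j < k < l)%N ->
    j \notin I -> k \notin I -> l \notin I ->
  (y I : F) * y (j |: (k |: (l |: I))) + (y (j |: (l |: I)) : F) * y (k |: I)
  = (y (j |: (k |: I)) : F) * y (l |: I) + (y (k |: (l |: I)) : F) * y (j |: I).

Lemma incident_parts_cube y : incident_parts y -> cube_equations y.
Proof.
move=> yy j k l I jkl jI kI lI.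
have [jk kl] := andP jkl; have jl := ltn_trans jk kl.
have [jNk kNl jNl] := ltn_ord_neq3 jkl.
rewrite -!flip_notin ?in_flip ?(negPf jNk) ?(negPf jNl) ?(negPf kNl) ?addbF //.
have oI : odd #|foldr (@flip n) I [:: j; k; l]| != odd #|I|.
  by rewrite /= !odd_flip; case: (odd _).
have ujkl : uniq [:: j; k; l] by rewrite /= !inE !negb_or jNk jNl kNl.
have := incident_parts_omega yy oI.
rewrite omega_foldr_flip // !big_cons big_nil /= [X in _ = X]mulrC => <-.
rewrite flipK (flipC k j) flipK (flipC l j) (flipC l k) flipK.
rewrite !sgn_flip !ltnn jk kl jl (ltnNge k j) (ltnNge l j) (ltnNge l k).
rewrite (ltnW jk) (ltnW kl) (ltnW jl) /=.
have := sgn_sqr F j I; have := sgn_sqr F k I; have := sgn_sqr F l I.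
move: (sgn F j I) (sgn F k I) (sgn F l I) => sj sk sl El Ek Ej.
rewrite !(expr0, expr1, mul1r, mulN1r, mulNr, opprK) El Ek Ej !mul1r addr0.
by ring.
Qed.

Lemma cube_determined x y : cube_equations x -> cube_equations y ->
    (forall J, x J != 0) -> (forall J, (#|J| <= 2)%N -> y J = x J) ->
  y = x.
Proof.
move=> xcube ycube xN0 yx2; apply/ffunP=> J.
have [m] := ubnP #|J|; elim: m J => // m IHm J Jm.
have [|/set_card_gt2_sorted[j [k [l [I [jkl jI kI lI JE]]]]]] := leqP #|J| 2.
  exact: yx2.
have [jNk kNl jNl] := ltn_ord_neq3 jkl.
have cJ : #|J| = #|I|.+3.
  by rewrite JE !cardsU1 !inE !negb_or jNk jNl kNl jI kI lI.
have IH K : (#|K| < #|I|.+3)%N -> y K = x K.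
  by move=> KI; apply/IHm/(leq_trans KI); rewrite -cJ.
have cU i K c : (#|K| < c)%N -> (#|i |: K| < c.+1)%N.
  by move=> Kc; rewrite cardsU1 -[c.+1]add1n -addnS leq_add ?leq_b1.
have := ycube j k l I jkl jI kI lI; have := xcube j k l I jkl jI kI lI.
rewrite !(IH (_ |: I)) ?cU // !(IH (_ |: (_ |: I))) ?cU //.
rewrite (IH I) ?ltnS ?leqW // JE.
by move=> <- /addIr /(mulfI (xN0 I)).
Qed.

End IncidentParts.

Section Hyperbolic.

Variables (F : fieldType) (n : nat).
Implicit Types (i j : 'I_n) (r t : F) (s : ext F n) (K : {set 'I_n}).

Definition hyperbolic i r t : V F n :=
  r *: eb F (lshift n i) + t *: eb F (rshift n i).

Lemma rho_hyperbolic i r t s K :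
  rho (hyperbolic i r t) s K
  = (if i \in K then r else t) * (sgn F i K * s (flip i K)).
Proof.
transitivity (r * rho (eb F (lshift n i)) s K + t * rho (eb F (rshift n i)) s K).
  by rewrite linearDl !linearZl_LR !ffunE.
by rewrite rho_lshift rho_rshift; case: ifP; rewrite mulr0 ?addr0 ?add0r.
Qed.

(* The action of exp (r e_i e_j), as the square of e_i e_j vanishes if i <> j. *)
Definition unipotent i j r s : ext F n :=
  s + r *: rho (eb F (lshift n i)) (rho (eb F (lshift n j)) s).

Lemma unipotent_coord i j r s K : i != j ->
  unipotent i j r s K = s K + (if (i \in K) && (j \in K) then
    r * (sgn F i K * sgn F j (flip i K)) * s (flip j (flip i K)) else 0).
Proof.
move=> ij.
transitivity (s K + r * rho (eb F (lshift n i)) (rho (eb F (lshift n j)) s) K).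
  by rewrite !ffunE.
rewrite !rho_lshift in_flip (eq_sym j) (negPf ij) addbF.
by case: (i \in K); case: (j \in K); rewrite /= ?mulr0 // !mulrA.
Qed.

End Hyperbolic.

Section HyperbolicForm.

Variables (F : numFieldType) (n : nat).
Implicit Types (i j : 'I_n) (r t : F) (x : V F n) (s : ext F n).

Lemma form_hyperbolic i j r t r' t' :
  form (hyperbolic i r t) (hyperbolic j r' t')
  = 2%:R^-1 * (r * t' + t * r') * (i == j)%:R.
Proof.
rewrite /hyperbolic !linearDl !linearDr !linearZl_LR !linearZr_LR /= !form_eb.
rewrite !dual_lshift !dual_rshift eq_rlshift eq_lrshift eq_lshift eq_rshift.
by rewrite !mulr0n; field.
Qed.

Lemma form_hyperbolic_lshift i j r t :
  form (hyperbolic i r t) (eb F (lshift n j)) = 2%:R^-1 * t * (i == j)%:R.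
Proof.
rewrite linearDl !linearZl_LR /= !form_eb dual_lshift dual_rshift.
by rewrite eq_rlshift eq_lshift mulr0n; field.
Qed.

Lemma form_hyperbolic_rshift i j r t :
  form (hyperbolic i r t) (eb F (rshift n j)) = 2%:R^-1 * r * (i == j)%:R.
Proof.
rewrite linearDl !linearZl_LR /= !form_eb dual_lshift dual_rshift.
by rewrite eq_lrshift eq_rshift mulr0n; field.
Qed.

Lemma hyperbolic_unit i r : r != 0 ->
  form (hyperbolic i r r^-1) (hyperbolic i r r^-1) = 1.
Proof. by move=> r0; rewrite form_hyperbolic eqxx mulr1n; field. Qed.

(* With u = e_j + e_j^* and w = e_j - e_j^*, the product
   (u + t e_i) u (w - t e_i) w is - (1 + 2 t e_i e_j). *)
Lemma unipotent_rho i j r s (t := r / 2%:R) (x := eb F (lshift n i))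
    (u := hyperbolic j 1 1) (w := hyperbolic j 1 (-1)) : i != j ->
  unipotent i j r s = - rho (u + t *: x) (rho u (rho (w - t *: x) (rho w s))).
Proof.
move=> ij.
have uu : form u u = 1 by rewrite form_hyperbolic eqxx mulr1n; field.
have ww : form w w = -1 by rewrite form_hyperbolic eqxx mulr1n; field.
have xx : form x x = 0 by rewrite form_eb dual_lshift eq_rlshift mulr0.
have rho_xux v : rho x (rho u (rho x v)) = 0.
  have /eqP := rho_anticomm u x v; rewrite form_hyperbolic_lshift.
  rewrite (eq_sym j) (negPf ij) mulr0 mul0rn scale0r addr_eq0 => /eqP->.
  by rewrite linearN /= rho_sqr xx scale0r oppr0.
have rho_u v : rho (u + t *: x) (rho u v) = v + t *: rho x (rho u v).
  by rewrite linearDl linearZl_LR /= rho_sqr uu scale1r.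
have -> : rho (w - t *: x) (rho w s) = - (s + t *: rho x (rho w s)).
  by rewrite linearBl linearZl_LR /= rho_sqr ww scaleN1r opprD.
rewrite rho_u !linearN /= -opprD opprK.
rewrite [s + t *: _]addrC [rho u (_ + s)]linearP /=.
rewrite [rho x (_ + rho u s)]linearP /= rho_xux scaler0 add0r.
have -> : unipotent i j r s = s + r *: rho x (rho (2%:R^-1 *: (u + w)) s).
  rewrite addrACA -scalerDl -scalerDl subrr scale0r addr0 scalerA.
  by rewrite mulVf ?scale1r // pnatr_eq0.
rewrite linearZl_LR linearZ /= scalerA -/t [rho (u + w) s]linearDl.
rewrite [rho x (_ + rho w s)]linearD scalerDr /=.
by rewrite [in RHS]addrC addrA addrAC.
Qed.

Lemma incident_parts_rho x s : incident_parts s -> incident_parts (rho x s).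
Proof.
rewrite /incident_parts -(rho_parity_part x true) -(rho_parity_part x false).
by move=> ss; apply/incident_rho/incidentC.
Qed.

Lemma incident_parts_unipotent i j r s : i != j ->
  incident_parts s -> incident_parts (unipotent i j r s).
Proof.
move=> ij ss; rewrite unipotent_rho // -scaleN1r; apply: incident_partsZ.
by do 4!apply: incident_parts_rho.
Qed.

End HyperbolicForm.

Section CubeSolutions.

Variables (F : numFieldType) (n : nat).
Implicit Types (x y : ext F n) (J : {set 'I_n}).

(* (1, u) is incident for every u in W. *)
Lemma incident_parts_prescribed_le1 x : x set0 != 0 -> exists y,
  incident_parts y /\ forall J, (#|J| <= 1)%N -> y J = x J.
Proof.
move=> x0; pose w : V F n := row_mx (\row_(i < n) x [set i]) 0.
have pw b : parity_part b (vb F set0) = (~~ b)%:R *: vb F (set0 : {set 'I_n}).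
  by rewrite parity_part_vb cards0 eq_sym eqbF_neg.
have prho b : parity_part b (rho w (vb F set0)) = b%:R *: rho w (vb F set0).
  by rewrite -[b in LHS]negbK -rho_parity_part pw negbK linearZ.
pose y : ext F n := x set0 *: vb F set0 + rho w (vb F set0).
have py b :
    parity_part b y = if b then rho w (vb F set0) else x set0 *: vb F set0.
  rewrite linearD linearZ /= pw prho.
  by case: b; rewrite !(scale0r, scale1r, scaler0) ?add0r ?addr0.
exists y; split=> [|J J1].
  rewrite /incident_parts !py -[rho w _]scale1r.
  exact/incidentZ/incident_rho_self/omega_vac.
transitivity (x set0 * (J == set0)%:R + rho w (vb F set0) J).
  by rewrite !ffunE.
rewrite rho_coord; under eq_bigr do rewrite ffunE flip_eq0.
have [->|J0] := eqVneq J set0.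
  rewrite mulr1 big1 ?addr0 // => j _.
  by rewrite eq_sym -cards_eq0 cards1 mulr0.
have /cards1P[i ->] : #|J| == 1 by rewrite eqn_leq J1 card_gt0.
rewrite mulr0 add0r (bigD1 i) //= big1 => [|j /negPf ji].
  rewrite eqxx mulr1 addr0 /slot set11 row_mxEl mxE -[[set i]]setU0.
  by rewrite -flip_notin ?inE // sgn_flip_id sgn_set0 mul1r.
by rewrite (inj_eq set1_inj) eq_sym ji mulr0.
Qed.

Lemma incident_parts_prescribed_le2 x : x set0 != 0 -> exists y,
  incident_parts y /\ forall J, (#|J| <= 2)%N -> y J = x J.
Proof.
move=> x0; suff [y [yy yx]] : exists y, incident_parts y /\ forall J,
    (#|J| <= 2)%N -> (#|J| <= 1)%N || (J \in enum {set 'I_n}) -> y J = x J.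
  by exists y; split=> // J J2; rewrite yx ?mem_enum ?orbT.
elim: (enum _) => [|J Js [y [yy yx]]].
  have [y [yy yx]] := incident_parts_prescribed_le1 x0; exists y; split=> // J _.
  by rewrite orbF; apply: yx.
have [/cards2P[i [j [ij JE]]]|J2] := boolP (#|J| == 2); last first.
  exists y; split=> // K K2; rewrite inE; have [KJ _|KJ KJs] := eqVneq K J.
    by apply: yx; rewrite // -ltnS ltn_neqAle K2 KJ J2.
  exact: yx.
pose c := sgn F i J * sgn F j (flip i J).
have c0 : c != 0 by rewrite mulf_neq0 ?sgn_neq0.
exists (unipotent i j ((x J - y J) / (c * x set0)) y).
split=> [|K K2]; first exact: incident_parts_unipotent.
rewrite unipotent_coord //; have [-> _|KJ] := eqVneq K J.
  rewrite JE !inE !eqxx orbT /= -JE -/c (_ : flip j (flip i J) = set0); last first.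
    by apply/eqP; rewrite flip_eq0 JE flip_in ?setU11 // setU1K ?inE.
  by rewrite (yx set0) ?cards0 //; field; apply/andP.
rewrite inE (negPf KJ) /= => KJs; rewrite yx // ifF ?addr0 //.
apply: contra_neqF KJ => /andP[iK jK]; apply/eqP; rewrite eq_sym eqEcard JE.
by rewrite subUset !sub1set iK jK cards2 ij.
Qed.

Lemma Y0_incident_parts x : Y0 x -> incident_parts x.
Proof.
move=> [xN0 xcube]; have [y [yy yx]] := incident_parts_prescribed_le2 (xN0 set0).
by rewrite -(cube_determined xcube (incident_parts_cube yy) xN0 yx).
Qed.

End CubeSolutions.

Section SpinAction.

Variables (F : fieldType) (n : nat).
Implicit Types (ws : seq (V F n)) (s : ext F n) (b : bool).

Definition spinact ws s : ext F n := foldr (@rho F n) s ws.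

Lemma spinact_is_linear ws : linear (spinact ws).
Proof.
by elim: ws => // w ws IH r x y; rewrite [LHS]/= -/(spinact ws _) IH linearP.
Qed.
HB.instance Definition _ ws :=
  GRing.isLinear.Build F (ext F n) (ext F n) _ (spinact ws)
    (spinact_is_linear ws).

Lemma spinact_cat ws ws' s : spinact (ws ++ ws') s = spinact ws (spinact ws' s).
Proof. exact: foldr_cat. Qed.

Lemma spinact_parity_part ws b s : ~~ odd (size ws) ->
  spinact ws (parity_part b s) = parity_part b (spinact ws s).
Proof.
move=> ews; suff -> : spinact ws (parity_part b s)
    = parity_part (odd (size ws) (+) b) (spinact ws s) by rewrite (negPf ews).
by elim: ws {ews} => //= w ws IH; rewrite IH rho_parity_part addNb.
Qed.

End SpinAction.

Section Reflections.

Variables (F : numFieldType) (n : nat).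
Implicit Types (w x y z : V F n) (ws : seq (V F n)) (s : ext F n).

Definition unit_vectors ws := all [pred w | form w w == 1] ws.

Definition reflection w y : V F n := y - (form w y *+ 2) *: w.

Definition reflections ws y : V F n := foldr reflection y ws.

Lemma reflection_is_linear w : linear (reflection w).
Proof.
move=> r x y; rewrite /reflection linearDr linearZr_LR /= mulrnDl scalerDl.
by rewrite opprD addrACA scalerBr scalerA mulrnAr.
Qed.

Lemma reflections_is_linear ws : linear (reflections ws).
Proof.
elim: ws => // w ws IH r x y.
by rewrite [LHS]/= -/(reflections ws _) IH reflection_is_linear.
Qed.
HB.instance Definition _ ws :=
  GRing.isLinear.Build F (V F n) (V F n) _ (reflections ws)
    (reflections_is_linear ws).

Lemma reflection_fix w y : form w y = 0 -> reflection w y = y.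
Proof. by rewrite /reflection => ->; rewrite mul0rn scale0r subr0. Qed.

Lemma form_reflection w y z :
  form w w = 1 -> form (reflection w y) (reflection w z) = form y z.
Proof.
move=> ww; rewrite /reflection !(linearBl, linearBr).
by rewrite !(linearZl_LR, linearZr_LR) /= (formC y w) ww; ring.
Qed.

Lemma reflectionK w : form w w = 1 -> involutive (reflection w).
Proof.
move=> ww y; rewrite {1}/reflection (_ : form w (reflection w y) = - form w y).
  by rewrite mulNrn scaleNr opprK subrK.
by rewrite /reflection linearBr linearZr_LR /= ww; ring.
Qed.

Lemma form_reflections ws y z :
  unit_vectors ws -> form (reflections ws y) (reflections ws z) = form y z.
Proof.
by elim: ws => //= w ws IH /andP[/eqP ww /IH uws]; rewrite form_reflection.
Qed.

Lemma reflections_inj ws : unit_vectors ws -> injective (reflections ws).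
Proof.
elim: ws => [_ y z //|w ws IH /= /andP[/eqP ww /IH ws_inj] y z].
by move/(can_inj (reflectionK ww))/ws_inj.
Qed.

Lemma reflections_cat ws ws' y :
  reflections (ws ++ ws') y = reflections ws (reflections ws' y).
Proof. exact: foldr_cat. Qed.

Lemma spinact_revK ws : unit_vectors ws -> cancel (spinact ws) (spinact (rev ws)).
Proof.
elim: ws => //= w ws IH /andP[/eqP ww /IH wsK] s.
by rewrite rev_cons -cats1 spinact_cat /= rho_unitK.
Qed.

Lemma spinact_rev ws : unit_vectors ws -> cancel (spinact (rev ws)) (spinact ws).
Proof.
by move=> uws s; rewrite -{1}[ws]revK spinact_revK // /unit_vectors all_rev.
Qed.

Lemma spinact_inj ws : unit_vectors ws -> injective (spinact ws).
Proof. by move=> uws; apply: can_inj (spinact_revK uws). Qed.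

Lemma incident_parts_spinact ws s :
  incident_parts s -> incident_parts (spinact ws s).
Proof. by elim: ws => //= w ws IH /IH; apply: incident_parts_rho. Qed.

(* A unit vector w acts on V by conjugation as minus the reflection along w. *)
Lemma rho_reflections ws x s : unit_vectors ws ->
  rho (reflections ws x) (spinact ws s) = (-1) ^+ size ws *: spinact ws (rho x s).
Proof.
elim: ws => [|w ws IH] /=; first by rewrite scale1r.
case/andP=> /eqP ww /IH {}IH; rewrite exprS mulN1r scaleNr -linearZ /= -IH.
apply/eqP; rewrite /reflection linearBl linearZl_LR /= rho_unitK //.
by rewrite subr_eq addrC -subr_eq opprK -rho_anticomm addrC.
Qed.

Definition spinword ws := ~~ odd (size ws) && unit_vectors ws.

Lemma spin_spinact ws : spinword ws -> spin (spinact ws).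
Proof.
by case/andP=> ews /allP uws; exists ws; split=> // x /uws /eqP.
Qed.

Lemma spin_vector_reflections ws :
  spinword ws -> spin_vector (spinact ws) (reflections ws).
Proof.
case/andP=> ews uws x s.
by rewrite rho_reflections // -signr_odd (negPf ews) scale1r.
Qed.

Lemma spinact_nseq w k s : form w w = 1 -> ~~ odd k -> spinact (nseq k w) s = s.
Proof.
move=> ww; rewrite -{2}[k]odd_double_half => /negPf->; rewrite add0n.
by elim: k./2 => // m IH; rewrite doubleS /= rho_unitK.
Qed.

End Reflections.

Section Separation.

Variables (F : numFieldType) (n : nat).
Implicit Types (y z v : V F n) (ms : seq (V F n)).

Lemma form_functional (f : {scalar V F n}) : exists v, forall x, form v x = f x.
Proof.
exists (\row_k ((f (eb F (dual k)) : F) *+ 2)) => x.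
rewrite formE [in RHS](row_sum_delta x) linear_sum mulr_sumr.
rewrite (reindex_inj (can_inj (@dualK n))) /=; apply: eq_bigr => k _.
by rewrite mxE dualK linearZ /= mulr2n; field.
Qed.

Lemma form_separate y ms : free (y :: ms) ->
  exists2 v, {in ms, forall m, form v m = 0} & form v y = 1.
Proof.
move=> yms; pose X := in_tuple (y :: ms).
have [v vE] := form_functional (coord X ord0).
exists v => [m mms|]; rewrite vE; last exact: (coord_free ord0 ord0).
have im : ((index m ms).+1 < size (y :: ms))%N by rewrite ltnS index_mem.
have := coord_free (X := X) (Ordinal im) ord0 yms.
by rewrite /= nth_index.
Qed.

Lemma form_separate2 y z ms : free (y :: ms) -> free (z :: ms) ->
  exists v, [/\ {in ms, forall m, form v m = 0}, form v y != 0 & form v z != 0].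
Proof.
move=> /form_separate[v1 v1m v1y] /form_separate[v2 v2m v2z].
have [v1z|v1z] := eqVneq (form v1 z) 0; last by exists v1; rewrite v1y oner_eq0.
have [v2y|v2y] := eqVneq (form v2 y) 0; last by exists v2; rewrite v2z oner_eq0.
exists (v1 + v2); rewrite !linearDl /= v1y v1z v2y v2z addr0 add0r !oner_eq0.
by split=> // m mm; rewrite linearDl /= v1m ?v2m ?addr0.
Qed.

End Separation.

Section Witt.

Variables (F : numClosedFieldType) (n : nat).
Implicit Types (w x y z : V F n) (ws ms ls : seq (V F n)).

Lemma reflection_swap y z : form y y = 0 -> form z z = 0 -> form y z != 0 ->
  exists w, [/\ form w w = 1, reflection w y = z
    & forall m, form m y = 0 -> form m z = 0 -> reflection w m = m].
Proof.
move=> yy zz yz; pose r := (sqrtC (- (form y z *+ 2)))^-1.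
have rr : r * r * (form y z *+ 2) = -1.
  by rewrite -expr2 exprVn sqrtCK invrN mulNr mulVf ?mulrn_eq0.
exists (r *: (y - z)); split=> [||m my mz].
- rewrite linearZl_LR linearZr_LR linearBl !linearBr /= yy zz (formC z).
  by rewrite -[1]opprK -rr; ring.
- rewrite /reflection linearZl_LR linearBl /= yy (formC z) scalerA -mulrnAl.
  by rewrite [X in X *: _](_ : _ = 1) ?scale1r ?subKr // -[1]opprK -rr; ring.
- apply: reflection_fix.
  by rewrite linearZl_LR linearBl /= !(formC _ m) my mz subrr mulr0.
Qed.

Lemma reflections_swap y z ms : form y y = 0 -> form z z = 0 ->
    {in ms, forall m, form m y = 0} -> {in ms, forall m, form m z = 0} ->
    free (y :: ms) -> free (z :: ms) ->
  exists ws, [/\ unit_vectors ws, reflections ws y = z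
    & {in ms, forall m, reflections ws m = m}].
Proof.
move=> yy zz my mz yms zms; have [yz|yz] := eqVneq (form y z) 0; last first.
  have [w [ww wyz wm]] := reflection_swap yy zz yz.
  exists [:: w]; split=> [||m mm]; rewrite /= ?ww ?eqxx //.
  by rewrite wm ?my ?mz.
(* Both y and z are swapped with an isotropic t that is orthogonal to ms. *)
have [v [vm vy vz]] := form_separate2 yms zms.
pose r := - form v v / (form v y *+ 2); pose t := v + r *: y.
have tt : form t t = 0.
  rewrite !(linearDl, linearDr) !(linearZl_LR, linearZr_LR) /= yy (formC y v).
  by rewrite /r; field.
have yt : form y t != 0 by rewrite linearDr linearZr_LR /= yy mulr0 addr0 formC.
have tz : form t z != 0 by rewrite linearDl linearZl_LR /= yz mulr0 addr0.
have mt : {in ms, forall m, form m t = 0}.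
  by move=> m mm; rewrite linearDr linearZr_LR /= formC vm // my // mulr0 addr0.
have [w [ww wyt wm]] := reflection_swap yy tt yt.
have [w' [ww' wtz wm']] := reflection_swap tt zz tz.
exists [:: w'; w]; split=> [||m mm]; rewrite /= ?ww ?ww' ?eqxx ?wyt //.
by rewrite wm ?my ?mt // wm' ?mz ?mt.
Qed.

Lemma witt_isotropic ls ms : size ls = size ms -> free ls -> free ms ->
    {in ls &, forall x y, form x y = 0} -> {in ms &, forall x y, form x y = 0} ->
  exists2 ws, unit_vectors ws & map (reflections ws) ls = ms.
Proof.
elim: ls ms => [|l ls IH] [|m ms] //=; first by exists [::].
case=> size_lm free_ls free_ms iso_ls iso_ms.
have [free_ls' free_ms'] : free ls /\ free ms.
  by move: free_ls free_ms; rewrite !free_cons => /andP[_ ->] /andP[_ ->].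
have [||ws uws wsE] := IH ms size_lm free_ls' free_ms'.
- by apply: sub_in2 iso_ls => x; apply: (@mem_behead _ (l :: ls)).
- by apply: sub_in2 iso_ms => x; apply: (@mem_behead _ (m :: ms)).
have ws_inj := reflections_inj uws.
have [||||||ws' [uws' ws'l ws'm]] := @reflections_swap (reflections ws l) m ms.
- by rewrite form_reflections // iso_ls ?mem_head.
- by rewrite iso_ms ?mem_head.
- move=> x; rewrite -wsE => /mapP[y yls ->].
  by rewrite form_reflections // iso_ls ?mem_head // inE yls orbT.
- by move=> x xms; rewrite iso_ms ?mem_head // inE xms orbT.
- move: free_ls; rewrite !free_cons free_ms' andbT => /andP[+ _]; apply: contra.
  rewrite -wsE -(eq_map (lfunE (reflections ws))) -limg_span.
  by move=> /memv_imgP[x xl]; rewrite lfunE => /ws_inj->.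
- exact: free_ms.
exists (ws' ++ ws); first by rewrite /unit_vectors all_cat; apply/andP.
rewrite reflections_cat ws'l; congr (_ :: _); rewrite -[RHS]map_id.
rewrite (eq_map (reflections_cat ws' ws)) (map_comp (reflections ws')) wsE.
exact/eq_in_map.
Qed.

End Witt.

Section Lines.

Variables (F : fieldType) (vT : vectType F).
Implicit Types (v w : vT) (U : {vspace vT}).

Lemma vline_eq v w : v != 0 -> v \in <[w]>%VS -> <[v]>%VS = <[w]>%VS.
Proof.
by move=> v0 vw; apply/eqP; rewrite eqEdim -memvE vw !dim_vline v0 leq_b1.
Qed.

Lemma vlineZ (r : F) v : r != 0 -> <[r *: v]>%VS = <[v]>%VS.
Proof.
move=> r0; have [->|v0] := eqVneq v 0; first by rewrite scaler0.
by apply: vline_eq; rewrite ?scaler_eq0 ?negb_or ?r0 ?memvZ ?memv_line.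
Qed.

Lemma dim1_vline U : \dim U = 1%N -> exists2 v, v != 0 & U = <[v]>%VS.
Proof.
move=> dU; have v0 : vpick U != 0 by rewrite vpick0 -dimv_eq0 dU.
exists (vpick U) => //; apply/esym/eqP.
by rewrite eqEdim -memvE memv_pick dim_vline v0 dU.
Qed.

End Lines.

Lemma free_map_dual (F : fieldType) (vT : vectType F) (I : eqType) (ks : seq I)
    (f : I -> vT) (lam : I -> {linear vT -> F^o}) : uniq ks ->
    {in ks &, forall k j, j != k -> lam k (f j) = 0} ->
    {in ks, forall k, lam k (f k) != 0} ->
  free (map f ks).
Proof.
elim: ks => [|k ks IH] /=; first by rewrite nil_free.
case/andP=> kks uks lam0 lamN0; rewrite free_cons IH // => [|i j iks jks|i iks].
- rewrite andbT; apply: contra (lamN0 k (mem_head _ _)) => fk.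
  have /subvP/(_ _ fk) : (<<map f ks>> <= lker (linfun (lam k)))%VS.
    apply/span_subvP=> _ /mapP[j jks ->]; rewrite memv_ker lfunE /=.
    by rewrite lam0 ?mem_head ?inE ?jks ?orbT //; apply: contraNneq kks => <-.
  by rewrite memv_ker lfunE.
- by apply: lam0; rewrite inE ?iks ?jks orbT.
- by apply: lamN0; rewrite inE iks orbT.
Qed.

Definition row_coord (F : fieldType) (d : nat) (k : 'I_d) (x : 'rV[F]_d) : F^o :=
  x 0 k.

Lemma row_coord_is_linear (F : fieldType) (d : nat) (k : 'I_d) :
  linear (@row_coord F d k).
Proof. by move=> r x y; rewrite /row_coord !mxE. Qed.
HB.instance Definition _ (F : fieldType) (d : nat) (k : 'I_d) :=
  GRing.isLinear.Build F 'rV[F]_d F^o _ (row_coord k) (row_coord_is_linear k).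

Section Annihilator.

Variables (F : fieldType) (n : nat).
Implicit Types (s : ext F n) (x : V F n) (L : {vspace V F n}) (b : bool).
Implicit Types (PQ : {vspace ext F n} * {vspace ext F n}).

Definition ann s : {vspace V F n} := lker (linfun (applyr (@rho F n) s)).

Lemma annP x s : reflect (rho x s = 0) (x \in ann s).
Proof. by rewrite memv_ker lfunE; apply: eqP. Qed.

Definition parity_lines s := (<[parity_part false s]>%VS, <[parity_part true s]>%VS).

Lemma projS_parity_lines PQ : projS PQ <->
  exists2 s, PQ = parity_lines s & forall b, parity_part b s != 0.
Proof.
have proj_line b v :
    v \in halfspin F n b -> v != 0 -> proj (halfspin F n b) <[v]>%VS.
  by move=> vb v0; split; rewrite ?dim_vline ?v0 // -memvE.
split=> [|[s -> sN0]]; last first.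
  by split; apply/proj_line; rewrite ?parity_part_halfspin.
case: PQ => P Q [[/= PS /dim1_vline[p p0 PE]] [/= QS /dim1_vline[q q0 QE]]].
have {PS} /halfspinP pS : p \in Splus F n by rewrite memvE -PE.
have {QS} /halfspinP qS : q \in Sminus F n by rewrite memvE -QE.
have sE b : parity_part b (p + q) = if b then q else p.
  by rewrite -{1}pS -{1}qS parity_part_add; case: b.
by exists (p + q) => [|b]; rewrite /parity_lines ?sE ?PE ?QE //; case: b.
Qed.

Lemma parity_lines_eqP s t : (forall b, parity_part b s != 0) ->
  parity_lines s = parity_lines t <->
  forall b, parity_part b s \in <[parity_part b t]>%VS.
Proof.
move=> sN0; split=> [st [] | st]; last by congr (_, _); apply: vline_eq.
- by rewrite -[<[_]>%VS]/(parity_lines t).2 -st memv_line.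
- by rewrite -[<[_]>%VS]/(parity_lines t).1 -st memv_line.
Qed.

Lemma segre_inj PQ PQ' :
  projS PQ -> projS PQ' -> segre PQ = segre PQ' -> PQ = PQ'.
Proof.
move=> /projS_parity_lines[s -> sN0] /projS_parity_lines[t -> _].
rewrite /segre /= !tensv_line => st.
have := memv_line (tens (parity_part false s) (parity_part true s)).
rewrite st => /tens_mem_line[] // s0 s1.
by apply/parity_lines_eqP => // -[].
Qed.

(* Cartan's correspondence: for an isotropic L of dimension n - 1, each
   half-spin representation contains a single line annihilated by L. *)
Definition pure_pair L PQ := exists s,
  [/\ forall b, parity_part b s != 0, (L <= ann s)%VS & PQ = parity_lines s].

Lemma pure_pair_projS L PQ : pure_pair L PQ -> projS PQ.
Proof. by case=> s [sN0 _ ->]; apply/projS_parity_lines; exists s. Qed.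

End Annihilator.

Section BasePoint.

Variables (F : fieldType) (n : nat) (i0 : 'I_n).
Implicit Types (s : ext F n) (x : V F n) (b : bool).

Definition baseset : {set 'I_(n + n)} := [set rshift n i | i in [set~ i0]].

Definition base : seq (V F n) := [seq eb F k | k <- enum baseset].

Lemma card_baseset : #|baseset| = n.-1.
Proof. by rewrite card_imset ?cardsC1 ?card_ord //; apply: rshift_inj. Qed.

Lemma basesetP k : reflect (exists2 i, i != i0 & k = rshift n i) (k \in baseset).
Proof.
apply: (iffP imsetP) => [[i + ->]|[i ii0 ->]]; last by exists i; rewrite ?inE.
by rewrite !inE => ii0; exists i.
Qed.

Lemma baseP x : reflect (exists2 i, i != i0 & x = eb F (rshift n i)) (x \in base).
Proof.
apply: (iffP mapP) => [[k]|[i ii0 ->]].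
  by rewrite mem_enum => /basesetP[i ii0 ->] ->; exists i.
by exists (rshift n i); rewrite // mem_enum; apply/basesetP; exists i.
Qed.

Lemma free_base : free base.
Proof.
apply: (free_map_dual (lam := fun k => @row_coord F (n + n) k)).
- exact: enum_uniq.
- by move=> k l _ _ lk; rewrite /= /row_coord mxE eq_sym (negPf lk) andbF.
- by move=> k _; rewrite /= /row_coord mxE !eqxx oner_eq0.
Qed.

Definition basespinor : ext F n := vb F set0 + vb F [set i0].

Lemma parity_part_basespinor b :
  parity_part b basespinor = vb F (if b then [set i0] else set0).
Proof.
rewrite linearD /= !parity_part_vb cards0 cards1.
by case: b; rewrite !(scale0r, scale1r) ?addr0 ?add0r.
Qed.

Lemma base_ann : {in base, forall x, x \in ann basespinor}.
Proof.
move=> _ /baseP[i ii0 ->]; apply/annP; rewrite linearDr /= rho_rshift_vac add0r.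
apply/ffunP=> K; rewrite [RHS]ffunE rho_rshift; case: ifPn => // iK.
rewrite ffunE (_ : flip i K == _ = false) ?mulr0 //.
by apply/eqP=> /setP/(_ i); rewrite in_flip eqxx (negPf iK) !inE (negPf ii0).
Qed.

Lemma base_ann_line s b : {in base, forall x, x \in ann s} ->
  parity_part b s \in <[parity_part b basespinor]>%VS.
Proof.
move=> bs; rewrite parity_part_basespinor; set I := if b then _ else _.
apply/vlineP; exists (s I); apply/ffunP=> K; rewrite !ffunE.
have [->|KI] := eqVneq K I.
  by rewrite /GRing.scale /= mulr1 /I; case: (b); rewrite ?cards1 ?cards0.
rewrite scaler0; case: ifPn => // /eqP oK.
have [i iK ii0] : exists2 i, i \in K & i != i0.
  apply/exists_inP; apply: contraNT KI.
  rewrite negb_exists_in => /forall_inP Ki0.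
  have : K \subset [set i0] by apply/subsetP=> i /Ki0; rewrite inE negbK.
  by rewrite subset1 /I -oK => /orP[]/eqP->; rewrite ?cards1 ?cards0.
have /annP/ffunP/(_ (flip i K)) : eb F (rshift n i) \in ann s.
  by apply/bs/baseP; exists i.
rewrite [RHS]ffunE rho_rshift in_flip iK eqxx flipK => /eqP.
by rewrite mulf_eq0 (negPf (sgn_neq0 _ _ _)) => /eqP.
Qed.

End BasePoint.

Section SpinOrbit.

Variables (F : numClosedFieldType) (n : nat) (i0 : 'I_n).
Implicit Types (s : ext F n) (L : {vspace V F n}) (b : bool).
Implicit Types (ws : seq (V F n)) (PQ : {vspace ext F n} * {vspace ext F n}).
Local Notation base := (base F i0).
Local Notation basespinor := (basespinor F i0).

Lemma spin_of_IG L : IG L ->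
  exists2 ws, spinword ws & map (reflections ws) base = vbasis L.
Proof.
case=> dimL isoL.
have [|||||ws uws wsE] := @witt_isotropic F n base (vbasis L).
- by rewrite size_map -cardE card_baseset size_tuple.
- exact: free_base.
- exact: basis_free (vbasisP L).
- move=> _ _ /baseP[i _ ->] /baseP[j _ ->].
  by rewrite form_eb dual_rshift eq_lrshift mulr0.
- by move=> x y /vbasis_mem xL /vbasis_mem yL; apply: isoL.
have [ows|ews] := boolP (odd (size ws)); last first.
  by exists ws; rewrite // /spinword ews.
(* The reflection along e_i0 + e_i0^* fixes the base and corrects the parity. *)
pose u : V F n := hyperbolic i0 1 1^-1.
exists (rcons ws u).
  rewrite /spinword size_rcons /= negbK ows /unit_vectors all_rcons.
  by rewrite -/(unit_vectors ws) uws /= hyperbolic_unit ?oner_neq0 ?eqxx.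
rewrite -wsE; apply/eq_in_map => _ /baseP[i ii0 ->].
rewrite -cats1 reflections_cat; congr (reflections _ _); apply: reflection_fix.
by rewrite form_hyperbolic_rshift eq_sym (negPf ii0) mulr0.
Qed.

Lemma sub_ann_spinact L ws s :
    spinword ws -> map (reflections ws) base = vbasis L ->
  (L <= ann (spinact ws s))%VS <-> {in base, forall x, x \in ann s}.
Proof.
move=> sws wsE; have [_ uws] := andP sws.
have annE x : (reflections ws x \in ann (spinact ws s)) = (x \in ann s).
  apply/annP/annP; rewrite (spin_vector_reflections sws); last first.
    by move=> ->; rewrite linear0.
  by rewrite -[RHS](linear0 (spinact ws)); apply: spinact_inj.
rewrite -(span_basis (vbasisP L)) -wsE; split=> [/span_subvP sub x xb|sub].
  by rewrite -annE; apply/sub/map_f.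
by apply/span_subvP=> _ /mapP[x xb ->]; rewrite annE sub.
Qed.

Lemma spinact_basespinor_neq0 ws b : spinword ws ->
  parity_part b (spinact ws basespinor) != 0.
Proof.
case/andP=> ews uws; rewrite -spinact_parity_part // parity_part_basespinor.
apply: contra_neq (vb_neq0 F (if b then [set i0] else set0)).
by rewrite -[X in _ = X -> _](linear0 (spinact ws)); apply: spinact_inj.
Qed.

Lemma pure_pair_spinact L ws PQ :
    spinword ws -> map (reflections ws) base = vbasis L ->
  pure_pair L PQ <-> PQ = parity_lines (spinact ws basespinor).
Proof.
move=> sws wsE; have [ews uws] := andP sws.
split=> [[s [sN0 + ->]]|->]; last first.
  exists (spinact ws basespinor); split=> // [b|].
    exact: spinact_basespinor_neq0.
  by apply/(sub_ann_spinact _ sws wsE)/base_ann.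
rewrite -{1}(spinact_rev uws s) => /(sub_ann_spinact _ sws wsE) Ls.
apply/parity_lines_eqP => // b.
have /vlineP[r] := base_ann_line b Ls; move/(congr1 (spinact ws)).
rewrite linearZ /= !spinact_parity_part // spinact_rev // => ->.
by rewrite memvZ ?memv_line.
Qed.

Lemma IG_pure_pair L : IG L -> exists PQ, pure_pair L PQ.
Proof.
move=> /spin_of_IG[ws sws wsE]; exists (parity_lines (spinact ws basespinor)).
exact/(pure_pair_spinact _ sws wsE).
Qed.

Definition spin_orbit PQ :=
  exists2 ws, spinword ws & PQ = parity_lines (spinact ws basespinor).

Lemma pure_pair_orbit L PQ : IG L -> pure_pair L PQ -> spin_orbit PQ.
Proof.
by move=> /spin_of_IG[ws sws wsE] /(pure_pair_spinact _ sws wsE) ->; exists ws.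
Qed.

End SpinOrbit.

Section Torus.

Variables (F : numFieldType) (n : nat).
Implicit Types (i j : 'I_n) (r : F) (T : ext2 F n) (J K : {set 'I_n}).

Definition torus i r : seq (V F n) :=
  [:: hyperbolic i r r^-1; hyperbolic i 1 1^-1].

Lemma spinword_torus i r : r != 0 -> spinword (torus i r).
Proof.
by move=> r0; rewrite /spinword /= !hyperbolic_unit ?oner_neq0 ?eqxx.
Qed.

Lemma spinact_torus_vb i r J :
  spinact (torus i r) (vb F J) = (if i \in J then r else r^-1) *: vb F J.
Proof.
apply/ffunP=> K; rewrite /= !rho_hyperbolic flipK sgn_flip_id invr1 if_same.
rewrite mul1r [X in _ * X]mulrA sgn_sqr mul1r !ffunE.
by have [->|_] := eqVneq K J; rewrite ?mulr0 ?scaler0.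
Qed.

Lemma reflections_torus i j r : r != 0 ->
  reflections (torus i r) (eb F (rshift n j))
  = (if j == i then (r ^+ 2)^-1 else 1) *: eb F (rshift n j).
Proof.
move=> r0; have [->|ji] := eqVneq j i; last first.
  rewrite scale1r /= !reflection_fix // form_hyperbolic_rshift eq_sym;
    by rewrite (negPf ji) mulr0.
have swap_i :
    reflection (hyperbolic i 1 1^-1) (eb F (rshift n i)) = - eb F (lshift n i).
  rewrite /reflection form_hyperbolic_rshift eqxx mulr1n !mulr1.
  rewrite -[_ *+ 2]mulr_natr mulVf ?pnatr_eq0 //.
  by rewrite scale1r /hyperbolic invr1 !scale1r opprD addrCA subrr addr0.
rewrite /= swap_i /reflection linearNr /= form_hyperbolic_lshift eqxx mulr1n.
rewrite mulr1 mulNrn -mulrnAl -[_ *+ 2]mulr_natr mulVf ?pnatr_eq0 // mul1r.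
rewrite scaleNr opprK /hyperbolic scalerDr !scalerA mulVf // scale1r.
by rewrite addrA addNr add0r -expr2 exprVn.
Qed.

Lemma torus_weight_eq0 i T J K (g := spinact (torus i 2%:R)) :
    tensmap g g T = (2%:R ^+ 2)^-1 *: T -> (i \in J) || (i \in K) ->
  T (J, K) = 0.
Proof.
move=> /ffunP/(_ (J, K)) + iJK; have gE := spinact_torus_vb i 2%:R.
rewrite (tensmap_diag _ _ _ gE gE) ffunE => TE.
set c := (if _ then _ else _) * _ in TE.
have cN : c - (2%:R ^+ 2)^-1 != 0; last first.
  by apply: (mulfI cN); rewrite mulr0 mulrBl TE subrr.
have -> : c - (2%:R ^+ 2)^-1 =
    if (i \in J) && (i \in K) then 15%:R / 4%:R else 3%:R / 4%:R.
  by move: iJK; rewrite /c; case: (i \in J); case: (i \in K) => //= _; field.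
by case: ifP => _; rewrite mulf_neq0 ?invr_eq0 ?pnatr_eq0.
Qed.

End Torus.

Section BaseTensor.

Variables (F : fieldType) (n : nat) (i0 : 'I_n).
Implicit Types (T : ext2 F n) (J K : {set 'I_n}).

Lemma tensv_support_base T : T \in tensv (Splus F n) (Sminus F n) ->
    (forall i J K, i != i0 -> (i \in J) || (i \in K) -> T (J, K) = 0) ->
  T = T (set0, [set i0]) *: tens (vb F set0) (vb F [set i0]).
Proof.
move=> TS T0; apply/ffunP=> -[J K]; rewrite !ffunE /= -natrM mulnb.
have [/andP[/eqP-> /eqP->]|JK] := boolP (_ && _).
  by rewrite /GRing.scale /= mulr1.
rewrite scaler0; have [/exists_inP[i ii0 iJK]|] :=
  boolP [exists (i | i != i0), (i \in J) || (i \in K)]; first exact: T0 iJK.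
rewrite negb_exists_in => /forall_inP JKi0.
have [Ji0 Ki0] : J \subset [set i0] /\ K \subset [set i0].
  by split; apply/subsetP=> i; rewrite inE; apply: contraTT => /JKi0;
    rewrite negb_or => /andP[].
apply: (tensv_halfspin_coord TS); apply: contraR JK; rewrite negb_or !negbK.
by move: Ji0 Ki0; rewrite !subset1 => /orP[]/eqP-> /orP[]/eqP->;
  rewrite ?cards0 ?cards1 ?eqxx.
Qed.

End BaseTensor.

Section Embedding.

Variables (F : numClosedFieldType) (n : nat) (i0 : 'I_n).
Variable phi : 'Hom(ext F (n + n), ext2 F n).
Hypothesis phi_equivariant : equivariant_inclusion phi.
Implicit Types (L : {vspace V F n}).

Local Notation w0 := (vb F (baseset i0)).

Lemma vb_baseset_extpow : w0 \in extpow F (n + n) n.-1.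
Proof.
by apply/memv_span/map_f; rewrite mem_filter mem_enum card_baseset eqxx.
Qed.

Lemma extmap_torus i r : r != 0 -> i != i0 ->
  extmap (reflections (torus i r)) w0 = (r ^+ 2)^-1 *: w0.
Proof.
move=> r0 ii0; pose c k := if k == rshift n i then (r ^+ 2)^-1 else 1.
have -> : extmap (reflections (torus i r)) w0 =
    wedges [seq c k *: eb F k | k <- enum (baseset i0)].
  rewrite extmap_vb; congr wedges; apply/eq_in_map => k.
  rewrite mem_enum => /basesetP[j _ ->].
  by rewrite reflections_torus // /c eq_rshift.
rewrite wedges_scale wedges_eb (bigD1_seq (rshift n i)) ?enum_uniq //=; last first.
  by rewrite mem_enum; apply/basesetP; exists i.
by rewrite /c eqxx big1 ?mulr1 // => k /negPf->.
Qed.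

Lemma phi_baseset : exists2 r : F, r != 0 &
  phi w0 = r *: tens (vb F set0) (vb F [set i0]).
Proof.
have [phiS phi_inj phi_eq] := phi_equivariant; have wU := vb_baseset_extpow.
have phiE : phi w0 = phi w0 (set0, [set i0]) *: tens (vb F set0) (vb F [set i0]).
  apply: tensv_support_base => [|i J K ii0].
    by apply: subvP phiS _ (memv_img _ wU).
  have two0 : 2%:R != 0 :> F by rewrite pnatr_eq0.
  have st := spinword_torus i two0; apply: torus_weight_eq0.
  rewrite -(phi_eq _ _ (spin_spinact st) (spin_vector_reflections st)) //.
  by rewrite extmap_torus // linearZ.
exists (phi w0 (set0, [set i0])) => //.
apply: contra_neq (vb_neq0 F (baseset i0)) => r0.
by apply: phi_inj; rewrite ?mem0v // phiE r0 scale0r linear0.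
Qed.

Lemma IG_embedding_pure_pair L PQ :
  IG L -> pure_pair L PQ -> segre PQ = IG_embedding phi L.
Proof.
move=> /(spin_of_IG i0)[ws sws wsE] /(pure_pair_spinact _ sws wsE) ->.
have [_ _ phi_eq] := phi_equivariant; have [r r0 phiE] := phi_baseset.
have := phi_eq _ _ (spin_spinact sws) (spin_vector_reflections sws) _
  vb_baseset_extpow.
rewrite phiE extmap_vb (map_comp (reflections ws)) -/(base F i0) wsE => phiL.
rewrite /IG_embedding /plucker limg_line phiL linearZ /= tensmap_tens vlineZ //.
have [ews _] := andP sws.
by rewrite /segre tensv_line -!spinact_parity_part // !parity_part_basespinor.
Qed.

End Embedding.

Section Slices.

Variables (F : fieldType) (n : nat).
Implicit Types (p q : ext F n) (J K : {set 'I_n}) (j k l m : 'I_n).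

(* The contraction of omega p q with the K-th coordinate of its second factor is
   the action of slice q K on p. *)
Definition slice q K : V F n := \row_k rho (eb F (dual k)) q K.

Lemma incident_slice p q K : incident p q -> rho (slice q K) p = (p K : F) *: q.
Proof.
move=> pq; rewrite rhoE; apply/ffunP=> J.
transitivity (omega p q (J, K)); last first.
  by rewrite pq !ffunE /GRing.scale /= mulrC.
rewrite !sum_ffunE; apply: eq_bigr => k _.
by rewrite mxE [LHS]ffunE [RHS]ffunE /GRing.scale /= mulrC.
Qed.

Lemma omega_flip_eq0 p J k l : omega p p (flip k J, flip l J) = 0.
Proof.
have [->|kl] := eqVneq k l.
  by rewrite (omega_foldr_flip _ _ _ (js := [::])) ?big_nil.
have -> : flip k J = foldr (@flip n) (flip l J) [:: k; l] by rewrite /= flipK.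
rewrite omega_foldr_flip ?big_cons ?big_nil /= ?inE ?kl //.
rewrite !flipK !sgn_flip_id (flipC l k) addr0 [sgn F l (flip k J) * _]mulrC.
by rewrite !sgn_mul_flip (sign_ltn_anti _ kl); ring.
Qed.

Lemma slice_coord p J j k : slice p (flip j J) 0 (slot k J) =
  if j == k then sgn F k J * p J else 0.
Proof.
rewrite mxE; have [->|jk] := eqVneq j k.
  have -> : dual (slot k J) = slot k (flip k J) by rewrite slot_flip eqxx.
  by rewrite rho_eb_slot flipK sgn_flip_id.
have -> : slot k J = slot k (flip j J) by rewrite slot_flip eq_sym (negPf jk).
exact: rho_eb_dual_slot.
Qed.

Lemma incident_neighbour p q J : incident p q -> p J != 0 -> q != 0 ->
  exists m, q (flip m J) != 0.
Proof.
move=> pq pJ q0; apply/existsP; apply: contraNT q0.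
rewrite negb_exists => /forallP qJ.
have sJ : slice q J = 0.
  apply/rowP=> k; rewrite !mxE rho_coord big1 // => j _.
  by rewrite (eqP (negbNE (qJ j))) mulr0.
by apply/eqP/(scalerI pJ); rewrite scaler0 -(incident_slice J pq) sJ linear0l.
Qed.

Definition slice_relation p q J m k : V F n :=
  (q (flip m J) : F) *: slice p (flip k J)
  - (q (flip k J) : F) *: slice p (flip m J).

Lemma slice_relation_coord p q J m k j : k != m ->
  slice_relation p q J m j 0 (slot k J) =
  if j == k then (q (flip m J) : F) * (sgn F k J * p J) else 0.
Proof.
move=> km; transitivity ((q (flip m J) : F) * slice p (flip j J) 0 (slot k J)
    - (q (flip j J) : F) * slice p (flip m J) 0 (slot k J)); first by rewrite !mxE.
rewrite !slice_coord (eq_sym m) (negPf km) mulr0 subr0.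
by case: ifP; rewrite ?mulr0.
Qed.

Lemma free_slice_relation p q J m : p J != 0 -> q (flip m J) != 0 ->
  free [seq slice_relation p q J m k | k <- enum [set~ m]].
Proof.
move=> pJ qm; apply: (free_map_dual (lam := fun k => @row_coord F _ (slot k J))).
- exact: enum_uniq.
- move=> k j; rewrite !mem_enum !inE /= /row_coord => km _ /negPf jk.
  by rewrite slice_relation_coord // jk.
- move=> k; rewrite mem_enum !inE /= /row_coord => km.
  by rewrite slice_relation_coord // eqxx !mulf_neq0 ?sgn_neq0.
Qed.

End Slices.

Section IncidentAnnihilators.

Variables (F : numFieldType) (n : nat).
Implicit Types (p q : ext F n) (J K : {set 'I_n}) (k m : 'I_n).

Lemma ann_isotropic p : p != 0 -> {in ann p &, forall x y, form x y = 0}.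
Proof.
move=> p0 x y /annP px /annP py; have /eqP := rho_anticomm x y p.
rewrite px py !linear0 addr0 eq_sym scaler_eq0 (negPf p0) orbF.
by rewrite mulrn_eq0 => /eqP.
Qed.

Lemma form_slice p J K :
  form (slice p J) (slice p K) = 2%:R^-1 * omega p p (J, K).
Proof.
rewrite omegaC formE /omega sum_ffunE; congr (_ * _); apply: eq_bigr => k _.
by rewrite !mxE dualK [RHS]ffunE mulrC.
Qed.

Lemma slice_relation_ann p q J m k : incident p q -> q (flip m J) != 0 ->
  slice_relation p q J m k \in (ann p :&: ann q)%VS.
Proof.
move=> pq qm; set f := slice_relation p q J m k.
have slice_q l : rho (slice p (flip l J)) q = (q (flip l J) : F) *: p.
  exact/incident_slice/incidentC.
have fq : rho f q = 0.
  by rewrite linearBl !linearZl_LR /= !slice_q !scalerA mulrC subrr.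
rewrite memv_cap; apply/andP; split; apply/annP => //.
apply: (scalerI qm); rewrite scaler0 -linearZ /= -slice_q.
have /eqP := rho_anticomm f (slice p (flip m J)) q.
rewrite fq linear0 addr0 => /eqP->; rewrite linearBl !linearZl_LR /=.
by rewrite !form_slice !omega_flip_eq0 !mulr0 subrr mul0rn scale0r.
Qed.

Lemma incident_IG p q : p != 0 -> q != 0 -> incident p q ->
  exists2 L, IG L & (L <= ann p :&: ann q)%VS.
Proof.
move=> p0 q0 pq; have /ext_neq0P[J pJ] := p0.
have [m qm] := incident_neighbour pq pJ q0.
have fL := free_slice_relation pJ qm; set f := map _ _ in fL.
have subL : (<<f>> <= ann p :&: ann q)%VS.
  by apply/span_subvP=> _ /mapP[k _ ->]; apply: slice_relation_ann.
exists <<f>>%VS => //; split.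
  by rewrite (eqnP fL) size_map -cardE cardsC1 card_ord.
apply: sub_in2 (ann_isotropic p0) => x /(subvP subL).
by rewrite memv_cap => /andP[].
Qed.

End IncidentAnnihilators.

Section IncidenceVariety.

Variables (F : fieldType) (n : nat).
Implicit Types (s y : ext F n) (J K : {set 'I_n}) (r t : F) (b : bool).
Implicit Types (PQ : {vspace ext F n} * {vspace ext F n}).

Definition rescale r t s : ext F n :=
  r *: parity_part false s + t *: parity_part true s.

Lemma rescaleE r t s J : rescale r t s J = (if odd #|J| then t else r) * s J.
Proof.
by rewrite !ffunE; case: (odd _); rewrite scaler0 ?addr0 ?add0r.
Qed.

Lemma rescale1 s : rescale 1 1 s = s.
Proof. by rewrite /rescale !scale1r parity_partD. Qed.

Lemma parity_part_rescale b r t s :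
  parity_part b (rescale r t s) = (if b then t else r) *: parity_part b s.
Proof.
apply/ffunP=> J; rewrite ffunE rescaleE !ffunE.
by case: eqP => [<-|_]; rewrite ?scaler0.
Qed.

Lemma incident_parts_rescale r t s :
  incident_parts s -> incident_parts (rescale r t s).
Proof. by rewrite /incident_parts !parity_part_rescale; apply: incidentZ. Qed.

Lemma vanishes_parity_lines f s : vanishes f (parity_lines s) <->
  forall r t, f.@[fun i => rescale r t s (enum_val i)] = 0.
Proof.
split=> [fs r t|fs _ _ /vlineP[r ->] /vlineP[t ->]]; last exact: fs.
by apply: fs; rewrite memvZ ?memv_line.
Qed.

Definition coordvar J : coordpoly F n := 'X_(enum_rank J).

Definition incidence_poly J K : coordpoly F n :=
  \sum_(j | (j \in J) != (j \in K))
    (sgn F j J * sgn F j K) *: (coordvar (flip j J) * coordvar (flip j K))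
  - coordvar J * coordvar K.

Lemma meval_incidence_poly y J K :
  (incidence_poly J K).@[fun i => y (enum_val i)]
  = omega y y (J, K) - (y J : F) * y K.
Proof.
have yE I : (coordvar I).@[fun i => y (enum_val i)] = y I.
  by rewrite mevalXU enum_rankK.
rewrite mevalB mevalM !yE raddf_sum /= omega_coord; congr (_ - _).
by apply: eq_bigr => j _; rewrite mevalZ mevalM !yE.
Qed.

Lemma bihomog_coordvar J K : odd #|J| != odd #|K| ->
  bihomog 1 1 (coordvar J * coordvar K).
Proof.
move=> JK m; rewrite /coordvar -mpolyXD msuppX inE => /eqP->.
have sum_U (P : pred 'I_#|{set 'I_n}|) i : (\sum_(k | P k) U_(i)%MM k = P i)%N.
  under eq_bigr do rewrite mnm1E.
  rewrite big_mkcond (bigD1 i) //= eqxx big1 => [|k ki]; last first.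
    by rewrite eq_sym (negPf ki) if_same.
  by rewrite addn0; case: (P i).
split; under eq_bigr do rewrite mnmDE; rewrite big_split /= !sum_U !enum_rankK;
  by move: JK; case: (odd _); case: (odd _).
Qed.

Lemma bihomog_incidence_poly J K : odd #|J| != odd #|K| ->
  bihomog 1 1 (incidence_poly J K).
Proof.
move=> JK m /msuppB_le; rewrite mem_cat => /orP[/msupp_sum_le|]; last first.
  exact: bihomog_coordvar.
case/flattenP=> ms /mapP[j _ ->] /msuppZ_le; apply: bihomog_coordvar.
by rewrite !odd_flip; case: (odd _) JK; case: (odd _).
Qed.

Definition incidence_variety PQ := exists s,
  [/\ forall b, parity_part b s != 0, incident_parts s & PQ = parity_lines s].

Lemma zclosed_incidence : zclosed incidence_variety.
Proof.
exists (fun f => exists J K, [/\ odd #|J|, ~~ odd #|K| & f = incidence_poly J K]).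
  move=> _ [J [K [oJ oK ->]]]; exists 1%N, 1%N; apply: bihomog_incidence_poly.
  by rewrite oJ (negPf oK).
move=> PQ; split=> [[s [sN0 ss ->]]|[/projS_parity_lines[s -> sN0] vs]].
  split=> [|_ [J [K [oJ oK ->]]]]; first by apply/projS_parity_lines; exists s.
  apply/vanishes_parity_lines => r t; rewrite meval_incidence_poly.
  have /incident_partsP -> // := incident_parts_rescale r t ss.
  exact: subrr.
exists s; split=> //; apply/incident_partsP=> J K oJ oK.
have /vanishes_parity_lines/(_ 1 1) : vanishes (incidence_poly J K) (parity_lines s).
  by apply: vs; exists J, K.
by rewrite rescale1 meval_incidence_poly => /eqP; rewrite subr_eq0 => /eqP.
Qed.

Lemma parity_part_neq0 (i : 'I_n) b s :
  (forall J, s J != 0) -> parity_part b s != 0.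
Proof.
move=> sN0; apply/ext_neq0P; exists (if b then [set i] else set0).
by rewrite ffunE; case: b; rewrite ?cards1 ?cards0 ?sN0.
Qed.

End IncidenceVariety.

Section IncidencePairs.

Variables (F : numFieldType) (n : nat).
Implicit Types (PQ : {vspace ext F n} * {vspace ext F n}).

Lemma X_incidence PQ : (0 < n)%N -> X PQ -> incidence_variety PQ.
Proof.
move=> n0; apply; first exact: zclosed_incidence.
move=> _ [x xY ->]; exists x; split=> // [b|]; last exact: Y0_incident_parts.
by apply: (parity_part_neq0 (Ordinal n0)); case: xY.
Qed.

Lemma incidence_pure_pair PQ :
  incidence_variety PQ -> exists2 L, IG L & pure_pair L PQ.
Proof.
case=> s [sN0 ss ->].
have [L LIG /subvP Ls] := incident_IG (sN0 false) (sN0 true) ss.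
exists L => //; exists s; split=> //; apply/subvP=> x /Ls; rewrite memv_cap.
by case/andP=> /annP xp /annP xq; apply/annP/rho_parity_part_eq0=> -[].
Qed.

End IncidencePairs.

Section PolynomialFunctions.

Variable R : comNzRingType.
Implicit Types (f g : R -> R).

Definition polyfun f := exists c : {poly R}, forall t, f t = c.[t].

Lemma eq_polyfun f g : f =1 g -> polyfun f -> polyfun g.
Proof. by move=> fg [c cE]; exists c => t; rewrite -fg. Qed.

Lemma polyfun_const r : polyfun (fun=> r).
Proof. by exists r%:P => t; rewrite hornerC. Qed.

Lemma polyfun_add f g : polyfun f -> polyfun g -> polyfun (fun t => f t + g t).
Proof. by move=> [c cE] [e eE]; exists (c + e) => t; rewrite hornerD cE eE. Qed.

Lemma polyfun_mul f g : polyfun f -> polyfun g -> polyfun (fun t => f t * g t).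
Proof. by move=> [c cE] [e eE]; exists (c * e) => t; rewrite hornerM cE eE. Qed.

Lemma polyfun_exp f k : polyfun f -> polyfun (fun t => f t ^+ k).
Proof. by move=> [c cE]; exists (c ^+ k) => t; rewrite horner_exp cE. Qed.

Lemma polyfun_big (op : R -> R -> R) idx (I : Type) (r : seq I) (P : pred I)
    (f : I -> R -> R) :
    (forall g h, polyfun g -> polyfun h -> polyfun (fun t => op (g t) (h t))) ->
    (forall i, polyfun (f i)) ->
  polyfun (fun t => \big[op/idx]_(i <- r | P i) f i t).
Proof.
move=> pop pf; elim: r => [|i r IH].
  by apply: eq_polyfun (polyfun_const idx) => t; rewrite big_nil.
apply: eq_polyfun (fun t => esym (big_cons _ _ _ _ _ _)) _.
by case: (P i) => //; apply: pop.
Qed.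

Lemma polyfun_meval (k : nat) (f : {mpoly R[k]}) (v : R -> 'I_k -> R) :
  (forall i, polyfun (v^~ i)) -> polyfun (fun t => f.@[v t]).
Proof.
move=> pv; apply: eq_polyfun (fun t => esym (mevalE _ _)) _.
apply: polyfun_big polyfun_add _ => m.
apply: polyfun_mul (polyfun_const _) _.
by apply: polyfun_big polyfun_mul _ => i; apply: polyfun_exp.
Qed.

End PolynomialFunctions.

Lemma polyfun_mul_eq0 (F : numDomainType) (f g : F -> F) t :
    polyfun f -> polyfun g -> (forall t, f t * g t = 0) -> g t != 0 ->
  forall t', f t' = 0.
Proof.
move=> [c cE] [e eE] fg0 gt t'; suff: c * e = 0.
  move/eqP; rewrite mulf_eq0 => /orP[]/eqP ce0.
    by rewrite cE ce0 horner0.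
  by rewrite eE ce0 horner0 eqxx in gt.
apply: (@roots_geq_poly_eq0 _ _ [seq i%:R | i <- iota 0 (size (c * e))]).
- by apply/allP=> _ /mapP[i _ ->]; rewrite /root hornerM -cE -eE fg0.
- by rewrite map_inj_uniq ?iota_uniq //; apply: mulrIn; rewrite oner_eq0.
- by rewrite size_map size_iota.
Qed.

Section PolynomialWordFunctions.

Variables (F : numDomainType) (U : lmodType F).
Implicit Types (f g : seq U -> F) (us vs : seq U) (uvs : seq (U * U)) (t : F).

Definition segments uvs t : seq U :=
  [seq (1 - t) *: uv.1 + t *: uv.2 | uv <- uvs].

Definition wordpolyfun f := forall uvs, polyfun (fun t => f (segments uvs t)).

Lemma segments0 us vs : size us = size vs -> segments (zip us vs) 0 = us.
Proof.
move=> uvs; rewrite -[RHS](unzip1_zip (t := vs)) ?uvs //.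
by apply: eq_map => uv; rewrite subr0 scale1r scale0r addr0.
Qed.

Lemma segments1 us vs : size us = size vs -> segments (zip us vs) 1 = vs.
Proof.
move=> uvs; rewrite -[RHS](unzip2_zip (s := us)) ?uvs //.
by apply: eq_map => uv; rewrite subrr scale1r scale0r add0r.
Qed.

(* The line through two words of the same length meets the zero locus of g in
   finitely many points, unless it is contained in it. *)
Lemma wordpolyfun_mul_eq0 f g us vs : wordpolyfun f -> wordpolyfun g ->
    (forall ws, f ws * g ws = 0) -> size us = size vs -> g vs != 0 ->
  f us = 0.
Proof.
move=> pf pg fg0 size_uv gv; rewrite -(segments0 size_uv).
apply: (polyfun_mul_eq0 (pf (zip us vs)) (pg (zip us vs)) (t := 1)) => [t|].
  exact: fg0.
by rewrite segments1.
Qed.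

End PolynomialWordFunctions.

Lemma wordpolyfun_spinact (F : numFieldType) (n : nat) (s : ext F n)
    (K : {set 'I_n}) :
  wordpolyfun (fun ws : seq (V F n) => spinact ws s K).
Proof.
move=> uvs; elim: uvs K => [|uv uvs IH] K; first exact: polyfun_const.
apply: eq_polyfun (fun t => esym (rho_coord _ _ _)) _.
apply: polyfun_big => [|j]; first exact: polyfun_add.
apply: polyfun_mul; last exact: IH.
apply: polyfun_mul; first exact: polyfun_const.
set k := slot j K; exists ((1 - 'X) * (uv.1 0 k)%:P + 'X * (uv.2 0 k)%:P) => t.
by rewrite !mxE !hornerE.
Qed.

Section Density.

Variables (F : numClosedFieldType) (n : nat) (i0 : 'I_n).
Implicit Types (ws : seq (V F n)) (PQ : {vspace ext F n} * {vspace ext F n}).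
Local Notation s0 := (basespinor F i0).

Lemma incident_parts_basespinor : incident_parts s0.
Proof.
rewrite /incident_parts !parity_part_basespinor.
have -> : vb F [set i0] = rho (eb F (lshift n i0)) (vb F set0).
  apply/ffunP=> K; rewrite rho_lshift !ffunE flip_eq0.
  have [->|_] := eqVneq K [set i0]; last by rewrite mulr0 if_same.
  by rewrite set11 mulr1 -[[set i0]]setU0 -flip_notin ?inE // sgn_flip_id sgn_set0.
exact/incident_rho_self/omega_vac.
Qed.

Lemma generic_spinword :
  exists2 ws, spinword ws & forall J, spinact ws s0 J != 0.
Proof.
pose x : ext F n := [ffun=> 1].
have xN0 J : x J != 0 by rewrite ffunE oner_neq0.
have xY : Y0 x by split=> [//|*]; rewrite !ffunE.
have x_inc : incidence_variety (parity_lines x).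
  exists x; split=> // [b|]; first exact: parity_part_neq0.
  exact: Y0_incident_parts.
have [L LIG /(pure_pair_orbit i0 LIG)[ws sws]] := incidence_pure_pair x_inc.
move=> /(parity_lines_eqP _ (fun b => parity_part_neq0 i0 b xN0)) xs.
exists ws => // J; apply: contraNneq (xN0 J) => sJ; apply/eqP.
have /vlineP[r /ffunP/(_ J)] := xs (odd #|J|).
by rewrite !ffunE eqxx sJ scaler0.
Qed.

Lemma spin_orbit_projS PQ : spin_orbit i0 PQ -> projS PQ.
Proof.
case=> ws sws ->; apply/projS_parity_lines; exists (spinact ws s0) => // b.
exact: spinact_basespinor_neq0.
Qed.

Lemma spinact_X0 ws :
  (forall J, spinact ws s0 J != 0) -> X0 (parity_lines (spinact ws s0)).
Proof.
move=> sN0; exists (spinact ws s0) => //; split=> //.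
exact/incident_parts_cube/incident_parts_spinact/incident_parts_basespinor.
Qed.

(* Two words of even length become equally long when each is padded with as many
   copies of a unit vector as the other has letters. *)
Lemma spin_orbit_X PQ : spin_orbit i0 PQ -> X PQ.
Proof.
move=> PQorb Z [E _ ZE] X0Z; apply/ZE.
split=> [|f Ef]; first exact: spin_orbit_projS.
have [ws /andP[ews _] ->] := PQorb.
have [ys /andP[eys _] ysN0] := generic_spinword.
apply/vanishes_parity_lines => r t; pose u : V F n := hyperbolic i0 1 1^-1.
have uu : form u u = 1 by apply/hyperbolic_unit/oner_neq0.
have <- : spinact (ws ++ nseq (size ys) u) s0 = spinact ws s0.
  by rewrite spinact_cat spinact_nseq.
apply: (wordpolyfun_mul_eq0
    (f := fun xs => f.@[fun i => rescale r t (spinact xs s0) (enum_val i)])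
    (g := fun xs => \prod_K spinact xs s0 K) (vs := ys ++ nseq (size ws) u)).
- move=> uvs; apply: polyfun_meval => i.
  apply: eq_polyfun (fun c => esym (rescaleE _ _ _ _)) _.
  by apply: polyfun_mul (polyfun_const _) _; apply: wordpolyfun_spinact.
- move=> uvs; apply: polyfun_big => [|K]; first exact: polyfun_mul.
  exact: wordpolyfun_spinact.
- move=> xs; have [/forallP xN0|] := boolP [forall K, spinact xs s0 K != 0].
    have /ZE[_ /(_ f Ef)/vanishes_parity_lines->] := X0Z _ (spinact_X0 xN0).
    exact: mul0r.
  rewrite negb_forall => /existsP[K]; rewrite negbK => /eqP xK.
  by rewrite (bigD1 K) //= xK mul0r mulr0.
- by rewrite !size_cat !size_nseq addnC.
- by apply/prodf_neq0 => K _; rewrite spinact_cat spinact_nseq.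
Qed.

End Density.

Theorem theorem5p3 (R : realType) (n : nat) (hn : (3 <= n)%N)
    (phi : 'Hom(ext R[i] (n + n), ext2 R[i] n))
    (hphi : equivariant_inclusion phi) :
  (forall L, IG L -> exists2 PQ, projS PQ & segre PQ = IG_embedding phi L) /\
  (forall PQ, X PQ <->
     projS PQ /\ exists2 L, IG L & segre PQ = IG_embedding phi L).
Proof.
have n_gt0 : (0 < n)%N by apply: leq_trans hn.
pose i0 := Ordinal n_gt0.
have segre_pair L PQ : IG L -> pure_pair L PQ -> segre PQ = IG_embedding phi L.
  exact: IG_embedding_pure_pair i0 phi hphi L PQ.
split=> [L LIG|PQ].
  have [PQ LPQ] := IG_pure_pair i0 LIG.
  by exists PQ; [apply: pure_pair_projS LPQ | apply: segre_pair].
split=> [/(X_incidence n_gt0)/incidence_pure_pair[L LIG LPQ]|[PQproj [L LIG PQE]]].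
  by split; [apply: pure_pair_projS LPQ | exists L => //; apply: segre_pair].
have [PQ' LPQ'] := IG_pure_pair i0 LIG.
have -> : PQ = PQ'.
  apply: segre_inj => //; first exact: pure_pair_projS LPQ'.
  by rewrite (segre_pair L PQ').
exact: spin_orbit_X (pure_pair_orbit i0 LIG LPQ').
Qed.
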